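(* Let $\mathcal F=\{f_i(x)=r_ix+b_i\}_{i=1}^m$ be a non-degenerate reverse iterated function system (on $\mathbb R$) such that $|r_i|\in\mathbb Z_{>1}$ and $b_i\in\mathbb Q$ for $1\le i\le m$, and let $a\in\mathbb Q$. If $\mathcal O^+_{\mathcal F}(a)$ has finite overlaps, then there exists an integer $N$ such that $N\mathcal O^+_{\mathcal F}(a)\subset\mathbb Z$ and $$\dim_{\mathrm L}\bigl(N\mathcal O^+_{\mathcal F}(a)\bigr)=\dim_{\mathrm{DH}}\bigl(N\mathcal O^+_{\mathcal F}(a)\bigr)=\dim_{\mathrm M}\mathcal O^+_{\mathcal F}(a)=\dim_{\mathrm{Be}}\mathcal O^+_{\mathcal F}(a)=\dim_{\mathrm H}K(\mathcal F^{-1})=d_{\mathcal F}=s,$$ where $s$ is the unique solution of $\sum_{i=1}^m|r_i|^{-s}=1$.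
   Context: The maps $f_1,\dots,f_m$ are distinct. $\mathcal F$ is degenerate if all the maps $f_i$ have a common fixed point, and non-degenerate otherwise. $G^*(\mathcal F)$ is the semigroup of distinct maps generated by $\mathcal F$ under composition (all nonempty finite compositions), $|g'|$ is the absolute value of the linear coefficient of $g$, and $d_{\mathcal F}=\lim_{R\to\infty}\log\#\{g\in G^*(\mathcal F):|g'|\le R\}/\log R$ (this limit always exists). The forward orbit is $\mathcal O^+_{\mathcal F}(a)=\{g(a):g\in G^*(\mathcal F)\}$; it has finite overlaps if $f_i(\mathcal O^+_{\mathcal F}(a))\cap f_j(\mathcal O^+_{\mathcal F}(a))$ is finite whenever $i\ne j$. $NE=\{Nx:x\in E\}$. $K(\mathcal F^{-1})\subset\mathbb R$ is the attractor of the contractive iterated function system $\mathcal F^{-1}=\{f_i^{-1}\}_{i=1}^m$ on $\mathbb R$, and $\dim_{\mathrm H}$ is Hausdorff dimension. $\dim_{\mathrm M}E$ is the common value, when they agree, of the $\liminf$ and $\limsup$ as $h\to\infty$ of $\log\#(E\cap[-h,h])/\log h$; $\dim_{\mathrm{Be}}E=\limsup_{h\to\infty}\sup_{x\in\mathbb R}\log\#(E\cap[x-h,x+h])/\log h$. Discrete dimensions of subsets of $\mathbb Z$ (Barlow–Taylor): for $x\in\mathbb Z$, $n\in\mathbb Z_{>0}$ let $C(x,n)=\{y\in\mathbb Z:x\le y<x+n\}$, $V(x,n)=\{y\in\mathbb Z:x-n/2\le y<x+n/2\}$, and let $\mathscr C$ be the collection of all $C(x,n)$. For a finite nonempty $A\subset\mathbb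 Z$ let $d(A)=\min\{r\in\mathbb Z_{>0}:A\subseteq C(x,r)\text{ for some }x\in\mathbb Z\}$. Let $V_n=V(0,2^n)$, $S_1=V_1$, $S_n=V_n\setminus V_{n-1}$ for $n\ge2$. For $A\subseteq\mathbb Z$, finite $F\subset\mathbb Z$ and $\alpha\ge0$ let $$\nu_\alpha(A,F)=\min\Bigl\{\sum_i\Bigl(\frac{d(U_i)}{d(F)}\Bigr)^\alpha:U_i\in\mathscr C,\ A\cap F\subseteq\bigcup_iU_i\Bigr\}.$$ Then $\dim_{\mathrm{DH}}A=\inf\{\alpha\ge0:\sum_{n=1}^\infty\nu_\alpha(A,S_n)<\infty\}$ and $\dim_{\mathrm L}A=\inf\{\alpha\ge0:\lim_{n\to\infty}\nu_\alpha(A,S_n)=0\}$. *)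

(* Defs.v *)
From HB Require Import structures.
From mathcomp Require Export all_boot all_order all_algebra.
From mathcomp Require Export all_classical all_reals all_analysis.
Set Implicit Arguments.
Unset Strict Implicit.
Unset Printing Implicit Defensive.
Import Order.TTheory GRing.Theory Num.Theory.
Import numFieldNormedType.Exports.
Local Open Scope classical_set_scope.
Local Open Scope ring_scope.

(* Affine maps and reverse iterated function systems on R *)

Definition affine (R : realType) (r b : R) : R -> R := fun x => r * x + b.

Definition affine_inv (R : realType) (r b : R) : R -> R := fun y => (y - b) / r.

Lemma affineK (R : realType) (r b : R) (hr : r != 0) :
  cancel (affine r b) (affine_inv r b) /\ cancel (affine_inv r b) (affine r b).
Proof.
split=> x; rewrite /affine /affine_inv; first by rewrite addrK mulrC mulKf.
by rewrite mulrC divfK // subrK.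
Qed.

(* For g x = r * x + b this is r. *)
Definition lin_coef (R : realType) (g : R -> R) : R := g 1 - g 0.

Definition reverse_IFS (R : realType) (m : nat) (r b : 'I_m -> R) : Prop :=
  (forall i, 1 < `|r i|) /\ injective (fun i => affine (r i) (b i)).

Definition degenerate (R : realType) (m : nat) (f : 'I_m -> R -> R) : Prop :=
  exists x, forall i, f i x = x.

(* Elements are functions, so two words giving the same map are counted once. *)
Inductive semigroup (R : realType) (m : nat) (f : 'I_m -> R -> R) :
    (R -> R) -> Prop :=
  | semigroup_gen i : semigroup f (f i)
  | semigroup_comp g h : semigroup f g -> semigroup f h -> semigroup f (g \o h).

Definition forward_orbit (R : realType) (m : nat) (f : 'I_m -> R -> R) (a : R) :
    set R :=
  [set g a | g in [set g | semigroup f g]].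

Definition finite_overlaps (R : realType) (m : nat) (f : 'I_m -> R -> R)
    (a : R) : Prop :=
  forall i j, i != j ->
    finite_set (f i @` forward_orbit f a `&` f j @` forward_orbit f a).

(* log #X / log h, in the extended reals: log 0 = -oo and log +oo = +oo. *)
Definition log_card_ratio (R : realType) (T : choiceType) (X : set T) (h : R) :
    \bar R :=
  (lne (counting X) * ((ln h)^-1)%:E)%E.

(* d_F = d *)
Definition is_growth_dim (R : realType) (m : nat) (f : 'I_m -> R -> R)
    (d : \bar R) : Prop :=
  log_card_ratio [set g | semigroup f g /\ `|lin_coef g| <= t] t
    @[t --> +oo%R] --> d.

(* The attractor is the unique K with this property when m > 0 and the maps g i
   are contractions. *)
Definition is_attractor (R : realType) (m : nat) (g : 'I_m -> R -> R)
    (K : set R) : Prop :=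
  [/\ K !=set0, compact K & K = \bigcup_(i in [set: 'I_m]) (g i @` K)].

(* Hausdorff dimension; the point 0 makes the diameter of the empty set 0. *)
Definition diameter (R : realType) (U : set R) : \bar R :=
  ereal_sup ([set 0%E] `|` [set `|x - y|%:E | x in U & y in U]).

Definition hausdorff_premeasure (R : realType) (t delta : R) (E : set R) :
    \bar R :=
  ereal_inf [set z | exists U : nat -> set R,
    [/\ forall i, (diameter (U i) <= delta%:E)%E,
        E `<=` \bigcup_i U i
      & z = (\sum_(0 <= i <oo) poweR (diameter (U i)) t)%E]].

Definition hausdorff_measure (R : realType) (t : R) (E : set R) : \bar R :=
  ereal_sup [set hausdorff_premeasure t delta E | delta in [set d | 0 < d]].

(* Since poweR 0 0 = 1, every cover costs +oo at t = 0, so t = 0 never belongs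
   to the set below; this does not change the infimum. *)
Definition hausdorff_dim (R : realType) (E : set R) : \bar R :=
  ereal_inf [set t%:E | t in [set t | 0 <= t /\ hausdorff_measure t E = 0%E]].

(* Mass dimension and discrete Beurling dimension *)

Definition is_mass_dim (R : realType) (E : set R) (d : \bar R) : Prop :=
  let f (h : R) := log_card_ratio (E `&` `[- h, h]) h in
  limf_einf f +oo%R = d /\ limf_esup f +oo%R = d.

Definition beurling_dim (R : realType) (E : set R) : \bar R :=
  limf_esup (fun h : R =>
    ereal_sup [set log_card_ratio (E `&` `[x - h, x + h]) h | x in [set: R]])
    +oo%R.

(* Discrete dimensions of Barlow and Taylor for subsets of Z *)

Definition Ccube (x : int) (n : nat) : set int := [set y | x <= y < x + n%:Z].

Definition Vcube (x : int) (n : nat) : set int :=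
  [set y | (x%:~R - n%:R / 2 <= y%:~R :> rat) /\
           (y%:~R < x%:~R + n%:R / 2 :> rat)].

Definition Ccubes : set (set int) :=
  [set U | exists x n, (0 < n)%N /\ U = Ccube x n].

(* For A finite and nonempty this is an infimum of a nonempty set of positive
   integers, hence a minimum. *)
Definition cube_size (R : realType) (A : set int) : R :=
  inf [set r%:R | r in [set r : nat | (0 < r)%N /\ exists x, A `<=` Ccube x r]].

Definition Vn (n : nat) : set int := Vcube 0 (2 ^ n).

(* Only n >= 1 is used. *)
Definition Sn (n : nat) : set int :=
  if n == 1 then Vn 1 else Vn n `\` Vn n.-1.

(* For F finite and alpha >= 0 the infimum is attained: a cover by k cubes costs
   at least k * d(F)^(-alpha), so only finitely many values lie below a given
   bound. *)
Definition nu (R : realType) (alpha : R) (A F : set int) : \bar R :=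
  ereal_inf [set z | exists (k : nat) (U : 'I_k -> set int),
    [/\ forall i, Ccubes (U i),
        A `&` F `<=` \bigcup_(i in [set: 'I_k]) U i
      & z = (\sum_(i < k) (cube_size R (U i) / cube_size R F) `^ alpha)%:E]].

Definition dim_DH (R : realType) (A : set int) : \bar R :=
  ereal_inf [set alpha%:E | alpha in [set alpha : R | 0 <= alpha /\
    (\sum_(1 <= n <oo) nu alpha A (Sn n) < +oo)%E]].

Definition dim_L (R : realType) (A : set int) : \bar R :=
  ereal_inf [set alpha%:E | alpha in [set alpha : R | 0 <= alpha /\
    nu alpha A (Sn n) @[n --> \oo] --> 0%E]].

Definition scale_set (R : realType) (N : int) (E : set R) : set R :=
  [set N%:~R * x | x in E].

Definition integer_points (R : realType) (E : set R) : set int :=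
  [set z | E z%:~R].

(* Main.v *)
Require Import Defs.
From mathcomp Require Import finmap ring lra zify.
Import Order.TTheory GRing.Theory Num.Theory.
Import numFieldNormedType.Exports.
Local Open Scope classical_set_scope.
Local Open Scope ring_scope.
Set Implicit Arguments.
Unset Strict Implicit.
Unset Printing Implicit Defensive.

(** Write [f i x = r i * x + b i], let [O] be the forward orbit of [a] and [s]
    the solution of [sum_i |r i|^(-s) = 1].  Everything follows from power laws
    with exponent [s] for two counting functions, plus a covering argument for
    the attractor.

    Upper bounds.  The orbit satisfies [O = union_i f i (O u {a})], so that the
    number of its points in an interval of radius [h >= 1] is at most 1 plus the
    sum over [i] of the number of points of [O u {a}] in an interval of radius
    [h / |r i|].  Intervals of radius less than 1 contain boundedly many orbit
    points, because [N * O] consists of integers for a common denominator [N].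
    As [sum_i (h / |r i|)^s = h^s], induction on the scale gives at most
    [C * h^s] points, uniformly in the centre.  The same recursion bounds the
    number of semigroup elements of ratio at most [h]
    ([self_similar_card_le]).

    Lower bounds.  Non-degeneracy makes [O] infinite ([orbit_infinite]).  As the
    pieces [f i (O)] overlap in a finite set, the recursion can be reversed up
    to an additive constant, which is absorbed once the count is large; hence
    there are at least [c * h^s] orbit points in [[-h, h]]
    ([self_similar_card_ge]).  Moreover [f i o g = f j o h] with [i != j] would
    give the infinite overlap [f i (g (O))], so the semigroup is free
    ([free_gen]), and its growth is bounded below by the same lemma.  These
    bounds determine the growth exponent, the mass dimension and the Beurling
    dimension.

    Discrete dimensions.  Covering the points of [N * O] in the shell [S_n] by
    unit cubes gives [nu_alpha <= C * 2^(n (s - alpha))], which is summable for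
    [alpha > s].  If [alpha < s], the uniform upper bound shows that a cover of
    the points in [S_n] costs at least 1 or a constant times
    [2^(- n s)] times their number; were these costs to tend to 0, the shells
    would contain too few points to account for the at least [c' * 2^(n s)]
    points in [V_n]
    ([exponent_ge_of_nu_cvg]).  As a finite sum of the [nu_alpha] also forces
    them to tend to 0, the same argument serves both dimensions.

    Hausdorff dimension.  The sets [K_w = {x | f_w x in K}], [w] a word of
    length [n], cover the attractor [K] and have diameter at most
    [diam K / |r_w|]; this gives the dimension at most [s].  The pieces may
    overlap, but only little: for [t < s], the sum of [|r_w|^(-t)] over the words
    of length [n] grows exponentially, while there are only polynomially many
    possible letter counts, and the letter counts determine [r_w].  Sorting the
    words also by the residue of [N * f_w 0] modulo a large integer, one class of
    words with common ratio [q] in absolute value has at least [q^t] elements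
    ([separated_words]).  By freeness the integers [N * f_w 0] in this class are
    distinct, hence far apart, so the pieces [K_w] are at distance at least
    [1 / q] from each other.  Induction on the number of intervals then bounds
    from below the sum of the [t]-th powers of the radii of any finite cover of
    [K]: small intervals meet at most one of the pieces, and magnifying those
    that meet [K_w] by [f_w] yields a cover of [K] by fewer intervals
    ([finite_cover_lower_bound]).  Compactness extends this to countable
    covers. *)

(** * Counting with duplicate-free lists *)

(** [X] has at most [B] elements: every duplicate-free list in [X] has length at
    most [B].  In particular [X] is finite. *)
Definition card_le (R : realType) (T : choiceType) (X : set T) (B : R) :=
  forall l : seq T, uniq l -> (forall x, x \in l -> X x) -> (size l)%:R <= B.

(** [X] has at least [B] elements; [X] may be infinite. *)
Definition card_ge (R : realType) (T : choiceType) (X : set T) (B : R) :=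
  exists l : seq T,
    [/\ uniq l, forall x, x \in l -> X x & B <= (size l)%:R].

Lemma card_le_ge0 (R : realType) (T : choiceType) (X : set T) (B : R) :
  card_le X B -> 0 <= B.
Proof. by move=> XB; apply: (XB [::]). Qed.

Lemma card_le_finite (R : realType) (T : choiceType) (X : set T) (B : R) :
  card_le X B -> finite_set X.
Proof.
move=> XB; apply: contrapT => Xinf.
have [F FX nF] := infinite_set_fset (Num.truncn B).+1 Xinf.
have := XB F (fset_uniq F) (fun x xF => FX x xF).
have B0 := card_le_ge0 XB.
apply/negP; rewrite -ltNge.
apply: (@lt_le_trans _ _ (Num.truncn B).+1%:R); last by rewrite ler_nat.
by rewrite truncnS_gt.
Qed.

Lemma counting_le (R : realType) (T : choiceType) (X : set T) (B : R) :
  card_le X B -> (counting X <= B%:E)%E.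
Proof.
move=> XB; have Xfin := card_le_finite XB.
rewrite /counting asboolT// lee_fin; apply: XB; first exact: fset_uniq.
by move=> x; rewrite in_fset_set// => /set_mem.
Qed.

Lemma counting_ge (R : realType) (T : choiceType) (X : set T) (B : R) :
  card_ge X B -> (B%:E <= counting X)%E.
Proof.
move=> [l [ul lX Bl]]; rewrite /counting.
case: asboolP => [Xfin|_]; last exact: leey.
rewrite lee_fin (le_trans Bl)// ler_nat.
by apply: uniq_leq_size => // x /lX Xx; rewrite in_fset_set// mem_set.
Qed.

Lemma card_le_sub (R : realType) (T : choiceType) (X Y : set T) (B C : R) :
  X `<=` Y -> B <= C -> card_le Y B -> card_le X C.
Proof.
move=> XY BC YB l ul lX; apply: le_trans BC; apply: YB => // x /lX; exact: XY.
Qed.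

Lemma card_ge_sub (R : realType) (T : choiceType) (X Y : set T) (B C : R) :
  X `<=` Y -> C <= B -> card_ge X B -> card_ge Y C.
Proof.
move=> XY CB [l [ul lX Bl]]; exists l; split => //; last exact: le_trans Bl.
by move=> x /lX; apply: XY.
Qed.

Lemma card_ge_le (R : realType) (T : choiceType) (X Y : set T) (B C : R) :
  card_ge X B -> card_le Y C -> X `<=` Y -> B <= C.
Proof.
move=> [l [ul lX Bl]] YC XY; apply: (le_trans Bl).
by apply: YC => // x /lX; apply: XY.
Qed.

Lemma card_ge_infinite (R : realType) (T : choiceType) (X : set T) (B : R) :
  infinite_set X -> card_ge X B.
Proof.
move=> Xinf; have [F FX nF] := infinite_set_fset (Num.truncn B).+1 Xinf.
exists (enum_fset F); split=> //.
by apply: ltW; apply: (lt_le_trans (truncnS_gt B)); rewrite ler_nat.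
Qed.


Lemma card_le_inj (R : realType) (T U : choiceType) (X : set T) (Y : set U)
    (g : T -> U) (B : R) :
  (forall x y, X x -> X y -> g x = g y -> x = y) -> (forall x, X x -> Y (g x)) ->
  card_le Y B -> card_le X B.
Proof.
move=> ginj gXY YB l ul lX; rewrite -(size_map g); apply: YB.
  by rewrite map_inj_in_uniq// => x y /lX Xx /lX Xy; apply: ginj.
by move=> _ /mapP[x xl ->]; apply/gXY/lX.
Qed.

Lemma card_ge_inj (R : realType) (T U : choiceType) (X : set T) (Y : set U)
    (g : T -> U) (B : R) :
  (forall x y, X x -> X y -> g x = g y -> x = y) -> (forall x, X x -> Y (g x)) ->
  card_ge X B -> card_ge Y B.
Proof.
move=> ginj gXY [l [ul lX lB]]; exists (map g l); split.
- by rewrite map_inj_in_uniq// => x y /lX Xx /lX Xy; apply: ginj.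
- by move=> _ /mapP[x xl ->]; apply/gXY/lX.
- by rewrite size_map.
Qed.

Lemma card_le_image (R : realType) (T U : choiceType) (X : set T) (Y : set U)
    (g : T -> U) (B : R) : Y `<=` g @` X -> card_le X B -> card_le Y B.
Proof.
move=> YgX XB l ul lY.
have [l' [l'X l'l]] : exists l', (forall x, x \in l' -> X x) /\ map g l' = l.
  elim: l {ul} lY => [|y l ih] lY; first by exists [::].
  have [|l' [l'X <-]] := ih; first by move=> x xl; apply: lY; rewrite inE xl orbT.
  have [x Xx <-] := YgX _ (lY y (mem_head _ _)).
  by exists (x :: l'); split=> // z; rewrite inE => /predU1P[->//|/l'X].
by rewrite -l'l size_map; apply: XB => //; apply: (@map_uniq _ _ g); rewrite l'l.
Qed.

Lemma flatten_map_uniq (I : eqType) (T : eqType) (F : I -> seq T) (s : seq I) :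
  uniq s -> (forall i, uniq (F i)) ->
  (forall i j x, i != j -> x \in F i -> x \in F j -> False) ->
  uniq (flatten (map F s)).
Proof.
move=> us uF dF; elim: s us => //= i s ih /andP[iNs us].
rewrite cat_uniq uF ih// andbT /=; apply/hasPn => x /flattenP[_ /mapP[j js ->] xj].
apply/negP => xi; apply: (dF i j x _ xi xj).
by apply: contraNN iNs => /eqP ->.
Qed.

(** * Self-similar counting *)

Lemma powR_le_lt0 (R : realType) (x y s : R) :
  0 < x -> x <= y -> 0 <= s -> x `^ s <= y `^ s.
Proof.
move=> x0 xy s0; apply: ge0_ler_powR => //; rewrite nnegrE; first exact: ltW.
exact: le_trans (ltW x0) xy.
Qed.

Lemma powR_ge1 (R : realType) (x s : R) : 1 <= x -> 0 <= s -> 1 <= x `^ s.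
Proof. by move=> x1 s0; rewrite -[leLHS](powRr0 x); apply: ler_powR. Qed.

(** The scale invariance that makes [h `^ s] a solution of the counting
    recursions below. *)
Lemma moran_sum_scale (R : realType) (m : nat) (q : 'I_m -> R) (s h : R) :
  (forall i, 2 <= q i) -> \sum_(i < m) q i `^ (- s) = 1 -> 0 <= h ->
  \sum_(i < m) (h / q i) `^ s = h `^ s.
Proof.
move=> q2 qs h0; rewrite -[RHS]mulr1 -qs mulr_sumr; apply: eq_bigr => i _.
have qi0 : 0 < q i by apply: lt_le_trans (q2 i).
by rewrite powRM ?invr_ge0// ?(ltW qi0)// -powR_inv1 ?(ltW qi0)// -powRrM mulN1r.
Qed.

(** The sum of the ratios serves as the common upper bound [Q]. *)
Lemma ratio_sup (R : realType) (m : nat) (q : 'I_m -> R) :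
  (1 < m)%N -> (forall i, 2 <= q i) ->
  exists Q : R, 1 <= Q /\ forall i, q i <= Q.
Proof.
move=> m1 q2; exists (\sum_i q i); split; last first.
  move=> i; rewrite (bigD1 i)//= lerDl sumr_ge0// => j _.
  by apply: le_trans (q2 j).
have i0 : 'I_m by exists 0%N; apply: ltn_trans m1.
rewrite (bigD1 i0)//= (@le_trans _ _ (q i0))//.
  by apply: le_trans (q2 i0); rewrite ler1n.
by rewrite lerDl sumr_ge0// => j _; apply: le_trans (q2 j).
Qed.

Lemma bernoulli_le (R : realType) (T : R) (n : nat) :
  1 <= T -> 1 + n%:R * (T - 1) <= T ^+ n.
Proof.
move=> T1; elim: n => [|n ih]; first by rewrite mul0r addr0 expr0.
rewrite exprS (@le_trans _ _ (T * (1 + n%:R * (T - 1))))//; last first.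
  by rewrite ler_pM2l//; lra.
rewrite -natr1 -subr_ge0.
rewrite (_ : _ - _ = n%:R * (T - 1) ^+ 2); last by ring.
by rewrite mulr_ge0// sqr_ge0.
Qed.

Lemma expr_unbounded (R : realType) (T B : R) : 1 < T ->
  exists n0, forall n, (n0 <= n)%N -> B < T ^+ n.
Proof.
move=> T1; exists (Num.truncn (B / (T - 1))).+1 => n nn.
apply: lt_le_trans (bernoulli_le n (ltW T1)).
have T0 : 0 < T - 1 by rewrite subr_gt0.
have : B / (T - 1) < n%:R by apply: (lt_le_trans (truncnS_gt _)); rewrite ler_nat.
by rewrite ltr_pdivrMr//; lra.
Qed.

Lemma lt_pow2 (R : realType) (h : R) : exists n : nat, h < 2 ^+ n.
Proof.
by have [|n nP] := @expr_unbounded _ 2 h; [rewrite ltr1n|exists n; exact: nP].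
Qed.

Lemma sum_nat_count (T : Type) (P : pred T) (l : seq T) :
  (\sum_(x <- l) P x = count P l)%N.
Proof. by rewrite -sum1_count [RHS]big_mkcond. Qed.

(** A family of sets [X p h] (centre [p], scale [h]) such that, for [h >= 1],
    [X p h] is covered by one point [e] and by images of the [X (par i p) (h / q i)]
    grows at most like [h `^ s].  The maps [phi i] need not be injective. *)
Lemma self_similar_card_le (R : realType) (m : nat) (q : 'I_m -> R) (s : R)
    (T : choiceType) (P : Type) (X : P -> R -> set T) (e : T)
    (phi : 'I_m -> T -> T) (par : 'I_m -> P -> P) (M : R) :
  (1 < m)%N -> (forall i, 2 <= q i) -> 0 <= s ->
  \sum_(i < m) q i `^ (- s) = 1 -> 0 <= M ->
  (forall p h, h < 1 -> card_le (X p h) M) ->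
  (forall p h x, 1 <= h -> X p h x ->
     x = e \/ exists i y, X (par i p) (h / q i) y /\ x = phi i y) ->
  exists C, 0 < C /\ forall p h, 1 <= h -> card_le (X p h) (C * h `^ s).
Proof.
move=> m1 q2 s0 qs M0 Xbase Xstep.
have [Q [Q1 qQ]] := ratio_sup m1 q2.
have Q0 : 0 < Q by apply: lt_le_trans Q1.
pose C := (M + 1) * Q `^ s.
have C0 : 0 < C by rewrite mulr_gt0 ?powR_gt0//; lra.
(* The term - 1 makes the bound inductive: the m >= 2 copies of it compensate
   for the extra point e. *)
suff main n p h : Q^-1 <= h -> h < 2 ^+ n -> card_le (X p h) (C * h `^ s - 1).
  exists C; split=> // p h h1; have [n hn] := lt_pow2 h.
  apply: (card_le_sub _ _ (main n p h _ hn)) => //.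
    by rewrite lerBlDr lerDl.
  by apply: le_trans h1; rewrite invf_le1.
have base p' h' : Q^-1 <= h' -> h' < 1 -> card_le (X p' h') (C * h' `^ s - 1).
  move=> Qh' h'1; apply: (card_le_sub _ _ (Xbase p' _ h'1)) => //.
  have h'0 : 0 < h' by apply: lt_le_trans Qh'; rewrite invr_gt0.
  rewrite /C -mulrA -powRM ?(ltW Q0) ?(ltW h'0)//.
  rewrite lerBrDr ler_peMr//; first by lra.
  by apply: powR_ge1 => //; rewrite -ler_pdivrMl// mulr1.
elim: n p h => [|n ih] p h Qh hn; first exact: base.
have [h1|h1] := ltP h 1; first exact: base.
move=> l ul lX.
pose F i :=
  [seq x <- l | `[< exists2 y, X (par i p) (h / q i) y & phi i y = x >]].
have sF i : (size (F i))%:R <= C * (h / q i) `^ s - 1.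
  have qi0 : 0 < q i by apply: lt_le_trans (q2 i).
  have : card_le [set phi i y | y in X (par i p) (h / q i)] (C * (h / q i) `^ s - 1).
    apply: (@card_le_image _ _ _ (X (par i p) (h / q i)) _ (phi i)) => //.
    apply: ih.
      rewrite ler_pdivlMr// mulrC ler_pdivrMr//.
      by apply: (le_trans (qQ i)); rewrite ler_peMl// ltW.
    rewrite ltr_pdivrMr// (lt_le_trans hn)// exprSr ler_pM2l ?exprn_gt0//.
  apply; first exact: filter_uniq.
  by move=> x; rewrite mem_filter => /andP[/asboolP].
have : (size l <= 1 + \sum_(i < m) size (F i))%N.
  have -> : size l = \sum_(x <- l) 1%N by rewrite sum1_size.
  apply: (@leq_trans (\sum_(x <- l) ((x == e) + \sum_(i < m) (x \in F i)))).
    rewrite big_seq [in leqRHS]big_seq; apply: leq_sum => x xl.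
    case: (Xstep _ _ _ h1 (lX _ xl)) => [->|[i [y [Xy xy]]]]; first by rewrite eqxx.
    rewrite (bigD1 i)//= mem_filter xl andbT asboolT; last by exists y.
    by rewrite addnCA leq_addr.
  rewrite big_split/= leq_add//.
    by rewrite (sum_nat_count (pred1 e)) count_uniq_mem ?leq_b1.
  rewrite exchange_big/=; apply: leq_sum => i _.
  rewrite (sum_nat_count (mem (F i))) -size_filter uniq_leq_size ?filter_uniq//.
  by move=> x; rewrite mem_filter => /andP[].
rewrite -(ler_nat R) => /le_trans; apply.
rewrite natrD natr_sum.
apply: (@le_trans _ _ (1 + \sum_(i < m) (C * (h / q i) `^ s - 1))).
  by rewrite lerD2l ler_sum.
rewrite sumrB sumr_const card_ord -mulr_sumr (moran_sum_scale q2 qs); last lra.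
have : 2 <= m%:R :> R by rewrite ler_nat.
by lra.
Qed.

Lemma size_filter_notin (T : eqType) (E l : seq T) : uniq l ->
  (size l <= size [seq x <- l | x \notin E] + size E)%N.
Proof.
move=> ul; rewrite !size_filter -(count_predC (mem E) l) addnC leq_add2l.
rewrite -size_filter uniq_leq_size ?filter_uniq//.
by move=> x; rewrite mem_filter => /andP[].
Qed.

(** A family of sets [Y h] containing the images of the [Y (h / q i)], where
    images with different indices only meet in the finite set [E], grows at least
    like [h `^ s], as soon as its members are large enough compared with [E]. *)
Lemma self_similar_card_ge (R : realType) (m : nat) (q : 'I_m -> R) (s : R)
    (T : choiceType) (Y : R -> set T) (phi : 'I_m -> T -> T) (E : seq T)
    (h1 : R) :
  (1 < m)%N -> (forall i, 2 <= q i) -> 0 <= s ->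
  \sum_(i < m) q i `^ (- s) = 1 -> 0 < h1 ->
  (forall i, injective (phi i)) ->
  (forall i h x, h1 <= h -> Y h x -> Y (h * q i) (phi i x)) ->
  (forall i j x y h k, i != j -> h1 <= h -> h1 <= k -> Y h x -> Y k y ->
     phi i x = phi j y -> phi i x \in E) ->
  (forall h, h1 <= h -> card_ge (Y h) ((m * size E).+1%:R : R)) ->
  exists c, 0 < c /\ forall h, h1 <= h -> card_ge (Y h) (c * h `^ s).
Proof.
move=> m1 q2 s0 qs h10 phiI Ystep Yovl Ybase.
have [Q [Q1 qQ]] := ratio_sup m1 q2.
have Q0 : 0 < Q by apply: lt_le_trans Q1.
have hQ0 : 0 < h1 * Q by rewrite mulr_gt0.
pose c := (h1 * Q) `^ (- s).
have c0 : 0 < c by rewrite powR_gt0.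
(* Dropping the points of E costs at most size E in each of the m images, so
   m >= 2 copies of the surplus m * size E pay for it. *)
suff main n h : h1 <= h -> h < h1 * Q * 2 ^+ n ->
    card_ge (Y h) (c * h `^ s + (m * size E)%:R).
  exists c; split=> // h h1h; have [n hn] := lt_pow2 (h / (h1 * Q)).
  apply: (card_ge_sub _ _ (main n h h1h _)) => //; first by rewrite lerDl.
  by rewrite mulrC -ltr_pdivrMr.
have base h' : h1 <= h' -> h' < h1 * Q ->
    card_ge (Y h') (c * h' `^ s + (m * size E)%:R).
  move=> h1h' h'Q; apply: (card_ge_sub _ _ (Ybase h' h1h')) => //.
  have h'0 : 0 < h' by apply: lt_le_trans h1h'.
  rewrite -natr1 addrC lerD2l /c powRN mulrC ler_pdivrMr ?powR_gt0// mul1r.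
  by apply: powR_le_lt0 => //; apply: ltW.
elim: n h => [|n ih] h h1h hn; first by apply: base => //; rewrite expr0 mulr1 in hn.
have [hQ|hQ] := ltP h (h1 * Q); first exact: base.
have hq i : h1 <= h / q i.
  have qi0 : 0 < q i by apply: lt_le_trans (q2 i).
  by rewrite ler_pdivlMr// (le_trans _ hQ)// ler_pM2l.
have /choice[l lP] i : exists l : seq T, [/\ uniq l, forall x, x \in l -> Y (h / q i) x
    & c * (h / q i) `^ s + (m * size E)%:R <= (size l)%:R].
  have qi0 : 0 < q i by apply: lt_le_trans (q2 i).
  apply: ih => //; rewrite ltr_pdivrMr// (lt_le_trans hn)//.
  by rewrite exprSr mulrA ler_pM2l// mulr_gt0// exprn_gt0.
pose F i := [seq x <- map (phi i) (l i) | x \notin E].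
have FY i x : x \in F i -> exists2 y, Y (h / q i) y & x = phi i y.
  rewrite mem_filter => /andP[_ /mapP[y yl ->]]; exists y => //.
  by have [_ + _] := lP i; apply.
exists (flatten (map F (enum 'I_m))); split.
- apply: flatten_map_uniq; first exact: enum_uniq.
    move=> i; rewrite filter_uniq// map_inj_uniq//.
    by have [] := lP i.
  move=> i j x ij xi; move: (xi); rewrite mem_filter => /andP[/negP xE _] xj.
  have [y Yy xy] := FY _ _ xi; have [z Yz xz] := FY _ _ xj.
  apply: xE; rewrite xy; apply: (Yovl i j y z _ _ ij _ _ Yy Yz) => //.
  by rewrite -xy.
- move=> x /flattenP[_ /mapP[i _ ->]] /FY[y Yy ->].
  have qi0 : 0 < q i by apply: lt_le_trans (q2 i).
  have := Ystep i _ _ (hq i) Yy.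
  by rewrite divfK// gt_eqF.
- rewrite size_flatten /shape -map_comp sumnE big_map big_enum/= natr_sum.
  apply: (@le_trans _ _ (\sum_(i < m) (c * (h / q i) `^ s + (m * size E)%:R - (size E)%:R))).
    rewrite sumrB big_split/= -mulr_sumr (moran_sum_scale q2 qs); last first.
      by rewrite (le_trans _ h1h)// ltW.
    rewrite -addrA lerD2l !sumr_const card_ord natrM.
    rewrite -[X in _ <= X - _]mulr_natl -[X in _ <= _ - X]mulr_natl -mulrBr.
    have m2 : 2 <= m%:R :> R by rewrite ler_nat.
    rewrite ler_pM2l; last by lra.
    have E0 : 0 <= (size E)%:R :> R by [].
    by move: E0 m2; move: (size E)%:R (m%:R : R) => a b a0 b2; nra.
  apply: ler_sum => i _; have [ul _ hl] := lP i.
  rewrite lerBlDr (le_trans hl)// -natrD ler_nat -(size_map (phi i)).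
  by rewrite size_filter_notin// map_inj_uniq.
Qed.

Lemma moran_sum_lt (R : realType) (m : nat) (q : 'I_m -> R) (x y : R) :
  (0 < m)%N -> (forall i, 2 <= q i) -> x < y ->
  \sum_(i < m) q i `^ (- y) < \sum_(i < m) q i `^ (- x).
Proof.
move=> m0 q2 xy; apply: ltr_sum.
  by apply/hasP; exists (Ordinal m0); rewrite ?mem_index_enum.
move=> i _; have q0 : 0 < q i by apply: lt_le_trans (q2 i).
rewrite /powR gt_eqF// ltr_expR ltr_pM2r ?ltrN2// ln_gt0//.
by apply: lt_le_trans (q2 i); rewrite ltr1n.
Qed.

Lemma moran_exponent (R : realType) (m : nat) (q : 'I_m -> R) :
  (1 < m)%N -> (forall i, 2 <= q i) ->
  exists s : R, 0 < s /\
    unique (fun t : R => \sum_(i < m) q i `^ (- t) = 1) s.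
Proof.
move=> m1 q2.
have q0 i : 0 < q i by apply: lt_le_trans (q2 i).
pose g t : R := \sum_(i < m) q i `^ (- t).
have gE t : g t = \sum_(i < m) expR (- t * ln (q i)).
  by apply: eq_bigr => i _; rewrite /powR gt_eqF.
have gdec x y : x < y -> g y < g x by apply: moran_sum_lt => //; apply: ltnW.
have gc : {within `[0, m%:R], continuous g}.
  apply: continuous_subspaceT => x.
  rewrite (_ : g = fun t => \sum_(i < m) expR (- t * ln (q i))); last exact/funext.
  apply: cvg_big => [|i _]; first exact: add_continuous.
  apply: continuous_cvg; first exact: continuous_expR.
  by apply: cvgM; [apply: cvgN; exact: cvg_id|exact: cvg_cst].
have g0 : g 0 = m%:R.
  rewrite /g (eq_bigr (fun=> 1)); last by move=> i _; rewrite oppr0 powRr0.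
  by rewrite sumr_const card_ord.
have gm : g m%:R <= 1.
  apply: (@le_trans _ _ (\sum_(i < m) 2 `^ (- m%:R))).
    apply: ler_sum => i _; rewrite !powRN lef_pV2 ?posrE ?powR_gt0//.
    by apply: powR_le_lt0.
  rewrite sumr_const card_ord powRN -[leLHS]mulr_natr ler_pdivrMl ?powR_gt0//.
  by rewrite mulr1 powR_mulrn// -natrX ler_nat ltnW// ltn_expl.
have [||s _ gs] := IVT (v := 1) _ gc; first by [].
  rewrite g0 min_r ?max_l ?gm/= ?ler1n ?(ltnW m1)//.
    by apply: le_trans gm _; rewrite ler1n ltnW.
  by apply: le_trans gm _; rewrite ler1n ltnW.
exists s; split.
  rewrite ltNge; apply/negP => s0.
  have : 1 < g 0 by rewrite g0 ltr1n.
  rewrite -gs; move: s0; rewrite le_eqVlt => /predU1P[->|/gdec]; rewrite ?ltxx//.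
  by move=> /lt_trans h /h; rewrite ltxx.
split=> [//|t gt]; case: (ltgtP s t) => // /gdec.
  by rewrite -/(g t) in gt; rewrite gs gt ltxx.
by rewrite -/(g t) in gt; rewrite gs gt ltxx.
Qed.

(** * From power laws to dimensions *)

Lemma log_card_ratio_le (R : realType) (C s e : R) : 0 < C -> 0 < e ->
  exists h1 : R, forall (h : R), h1 <= h -> forall (T : choiceType) (X : set T),
    card_le X (C * h `^ s) -> (log_card_ratio X h <= (s + e)%:E)%E.
Proof.
move=> C0 e0; exists (2 + expR (ln C / e)) => h hh T X XC.
have E0 := expR_gt0 (ln C / e).
have h0 : 0 < h by lra.
have lh0 : 0 < ln h by rewrite ln_gt0//; lra.
have Ch0 : 0 < C * h `^ s by rewrite mulr_gt0// powR_gt0.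
have lC : ln C <= e * ln h.
  rewrite -ler_pdivrMl// mulrC -[leLHS]expRK ler_ln ?posrE ?expR_gt0//; lra.
rewrite /log_card_ratio lee_pdivrMr// -EFinM.
have : (lne (counting X) <= lne (C * h `^ s)%:E)%E.
  rewrite lee_lne ?in_itv/= ?leey ?andbT; first exact: counting_le.
    by rewrite /counting; case: ifP => _; rewrite ?leey// lee_fin.
  by rewrite lee_fin ltW.
move=> /le_trans; apply; rewrite lne_EFin// lee_fin lnM ?posrE ?powR_gt0//.
by rewrite ln_powR; lra.
Qed.

Lemma log_card_ratio_ge (R : realType) (c s e : R) : 0 < c -> 0 < e ->
  exists h1 : R, forall (h : R), h1 <= h -> forall (T : choiceType) (X : set T),
    card_ge X (c * h `^ s) -> ((s - e)%:E <= log_card_ratio X h)%E.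
Proof.
move=> c0 e0; exists (2 + expR (- ln c / e)) => h hh T X Xc.
have E0 := expR_gt0 (- ln c / e).
have h0 : 0 < h by lra.
have lh0 : 0 < ln h by rewrite ln_gt0//; lra.
have ch0 : 0 < c * h `^ s by rewrite mulr_gt0// powR_gt0.
have lc : - ln c <= e * ln h.
  rewrite -ler_pdivrMl// mulrC -[leLHS]expRK ler_ln ?posrE ?expR_gt0//; lra.
rewrite /log_card_ratio lee_pdivlMr// -EFinM.
have : (lne (c * h `^ s)%:E <= lne (counting X))%E.
  rewrite lee_lne ?in_itv/= ?leey ?andbT; first exact: counting_ge.
    by rewrite lee_fin ltW.
  by rewrite /counting; case: ifP => _; rewrite ?leey// lee_fin.
apply: le_trans; rewrite lne_EFin// lee_fin lnM ?posrE ?powR_gt0//.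
by rewrite ln_powR; lra.
Qed.

Lemma limf_esup_le (R : realType) (f : R -> \bar R) (s : R) :
  (forall e : R, 0 < e -> exists h1 : R, forall h, h1 <= h ->
     (f h <= (s + e)%:E)%E) ->
  (limf_esup f +oo%R <= s%:E)%E.
Proof.
move=> fs; rewrite limf_esupE; apply/lee_addgt0Pr => e e0.
have [h1 h1P] := fs e e0.
apply: (@le_trans _ _ (ereal_sup [set f h | h in [set h | h1 < h]])).
  apply: ereal_inf_lbound; exists [set h | h1 < h] => //.
  by exists h1; split => //; exact: num_real.
by apply: ge_ereal_sup => _ [h /= hh <-]; apply/h1P/ltW.
Qed.

Lemma limf_esup_ge (R : realType) (f : R -> \bar R) (s : R) :
  (forall e : R, 0 < e -> exists h1 : R, forall h, h1 <= h ->
     ((s - e)%:E <= f h)%E) ->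
  (s%:E <= limf_esup f +oo%R)%E.
Proof.
move=> fs; rewrite limf_esupE; apply: le_ereal_inf_tmp => _ [V [M [_ MV]] <-].
apply/lee_subgt0Pr => e e0; have [h1 h1P] := fs e e0.
pose h := Num.max (M + 1) h1.
apply: (@le_trans _ _ (f h)); first by apply: h1P; rewrite le_max lexx orbT.
apply: ereal_sup_ubound; exists h => //; apply: MV.
by rewrite /h lt_max ltrDl ltr01.
Qed.

Lemma cvg_pinfty_squeeze (R : realType) (f : R -> \bar R) (s : R) :
  (forall e : R, 0 < e -> exists h1 : R, forall h, h1 <= h ->
     (f h <= (s + e)%:E)%E) ->
  (forall e : R, 0 < e -> exists h1 : R, forall h, h1 <= h ->
     ((s - e)%:E <= f h)%E) ->
  f t @[t --> +oo%R] --> s%:E.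
Proof.
move=> fle fge.
have fin e : 0 < e -> exists M, forall t, M < t ->
    exists2 x : R, f t = x%:E & `|s - x| <= e.
  move=> e0; have [h1 P1] := fle e e0; have [h2 P2] := fge e e0.
  exists (Num.max h1 h2) => t; rewrite gt_max => /andP[/ltW/P1 + /ltW/P2].
  case: (f t) => [x| |] //; rewrite !lee_fin => xs sx.
  by exists x => //; rewrite distrC ler_distl sx xs.
apply/fine_cvgP; split.
  have [M MP] := fin 1 ltr01; exists M; split; first exact: num_real.
  by move=> t /MP[x -> _].
apply/cvgrPdist_le => e e0; have [M MP] := fin e e0.
exists M; split; first exact: num_real.
by move=> t /MP[x fx xe]; rewrite /= fx.
Qed.

Lemma is_mass_dim_of_bounds (R : realType) (E : set R) (s c C h1 : R) :
  0 < c -> 0 < C ->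
  (forall h, h1 <= h -> card_ge (E `&` `[- h, h]) (c * h `^ s)) ->
  (forall h, h1 <= h -> card_le (E `&` `[- h, h]) (C * h `^ s)) ->
  is_mass_dim E s%:E.
Proof.
move=> c0 C0 Ege Ele.
pose f (h : R) := log_card_ratio (E `&` `[- h, h]) h.
have fle e : 0 < e -> exists k, forall h, k <= h -> (f h <= (s + e)%:E)%E.
  move=> e0; have [k kP] := log_card_ratio_le s C0 e0.
  exists (Num.max h1 k) => h; rewrite ge_max => /andP[h1h kh].
  exact/kP/Ele.
have fge e : 0 < e -> exists k, forall h, k <= h -> ((s - e)%:E <= f h)%E.
  move=> e0; have [k kP] := log_card_ratio_ge s c0 e0.
  exists (Num.max h1 k) => h; rewrite ge_max => /andP[h1h kh].
  exact/kP/Ege.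
split; last first.
  by apply/eqP; rewrite eq_le limf_esup_le ?limf_esup_ge.
rewrite /limf_einf; apply/eqP; rewrite eqe_oppLR -EFinN eq_le.
apply/andP; split; [apply: limf_esup_le|apply: limf_esup_ge] => e.
  move=> /fge[k kP]; exists k => h /kP; rewrite -leeN2 => /le_trans; apply.
  by rewrite -EFinN lee_fin; lra.
move=> /fle[k kP]; exists k => h /kP; rewrite -leeN2; apply: le_trans.
by rewrite -EFinN lee_fin; lra.
Qed.

Lemma beurling_dim_of_bounds (R : realType) (E : set R) (s c C h1 : R) :
  0 < c -> 0 < C ->
  (forall h, h1 <= h -> card_ge (E `&` `[- h, h]) (c * h `^ s)) ->
  (forall x h, h1 <= h -> card_le (E `&` `[x - h, x + h]) (C * h `^ s)) ->
  beurling_dim E = s%:E.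
Proof.
move=> c0 C0 Ege Ele; apply/eqP; rewrite eq_le; apply/andP; split.
  apply: limf_esup_le => e e0; have [k kP] := log_card_ratio_le s C0 e0.
  exists (Num.max h1 k) => h; rewrite ge_max => /andP[h1h kh].
  by apply: ge_ereal_sup => _ [x _ <-]; exact/kP/Ele.
apply: limf_esup_ge => e e0; have [k kP] := log_card_ratio_ge s c0 e0.
exists (Num.max h1 k) => h; rewrite ge_max => /andP[h1h kh].
apply: (@le_trans _ _ (log_card_ratio (E `&` `[0 - h, 0 + h]) h)).
  by rewrite sub0r add0r; exact/kP/Ege.
by apply: ereal_sup_ubound; exists 0.
Qed.

Lemma is_growth_dim_of_bounds (R : realType) (m : nat) (f : 'I_m -> R -> R)
    (s c C h1 : R) : 0 < c -> 0 < C ->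
  let G (h : R) := [set g : R -> R | semigroup f g /\ `|lin_coef g| <= h] in
  (forall h, h1 <= h -> card_ge (G h) (c * h `^ s)) ->
  (forall h, h1 <= h -> card_le (G h) (C * h `^ s)) ->
  is_growth_dim f s%:E.
Proof.
move=> c0 C0 G Gge Gle; apply: cvg_pinfty_squeeze => e e0.
  have [k kP] := log_card_ratio_le s C0 e0.
  exists (Num.max h1 k) => h; rewrite ge_max => /andP[h1h kh].
  exact/kP/Gle.
have [k kP] := log_card_ratio_ge s c0 e0.
exists (Num.max h1 k) => h; rewrite ge_max => /andP[h1h kh].
exact/kP/Gge.
Qed.

(** * The semigroup and the forward orbit *)

Lemma card_le_ltn (R : realType) (n : nat) :
  card_le [set k : nat | (k < n)%N] (n%:R : R).
Proof.
move=> l ul lX; rewrite ler_nat -(size_iota 0 n) uniq_leq_size//.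
by move=> x /lX xn; rewrite mem_iota.
Qed.

(** An interval of radius less than 1 contains at most [2 * N + 1] points [x] such
    that [N * x] is an integer. *)
Lemma card_le_lattice (R : realType) (N : nat) (p h : R) : (0 < N)%N -> h < 1 ->
  card_le [set x : R | N%:R * x \is a Num.int /\ `|x - p| <= h] ((2 * N).+1%:R : R).
Proof.
move=> N0 h1.
have N0' : 0 < N%:R :> R by rewrite ltr0n.
pose F := Num.floor (N%:R * (p - h) : R).
have key (x : R) : N%:R * x \is a Num.int -> `|x - p| <= h ->
    exists k : nat, (k < (2 * N).+1)%N /\ N%:R * x = (F + k%:Z)%:~R.
  move=> /intrP[z zx]; rewrite ler_distl => /andP[x1 x2].
  have Fz : F <= z.
    by rewrite -(@intrKfloor R z) -zx; apply: le_floor; rewrite ler_pM2l.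
  have zF : z < F + (2 * N).+1%:Z.
    rewrite -(ltr_int R) -zx intrD.
    have := floorD1_gt (N%:R * (p - h)); rewrite -/F intrD /=.
    have -> : ((2 * N).+1%:Z%:~R : R) = 2 * N%:R + 1.
      by rewrite -pmulrn -[LHS]natr1 natrM.
    have : N%:R * x <= N%:R * (p + h) by rewrite ler_pM2l.
    have : N%:R * h < N%:R * 1 by rewrite ltr_pM2l.
    by rewrite !mulrDr mulrN; lra.
  exists `|z - F|%N; split; first by lia.
  by rewrite zx; congr (_%:~R); lia.
apply: (@card_le_inj _ _ _ _ [set k : nat | (k < (2 * N).+1)%N]
  (fun x => `|Num.floor (N%:R * x) - F|%N)); last exact: card_le_ltn.
  move=> x y [xi xp] [yi yp].
  have [k [_ kx]] := key x xi xp; have [j [_ jy]] := key y yi yp.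
  rewrite kx jy !intrKfloor !(addrC F) !addrK /= => kj.
  by apply: (mulfI (lt0r_neq0 N0')); rewrite kx jy kj.
move=> x [xi xp]; have [k [kN kx]] := key x xi xp.
by rewrite /= kx intrKfloor (addrC F) addrK.
Qed.

Lemma seq_argmax (R : realType) (T : eqType) (F : T -> R) (l : seq T) (x0 : T) :
  x0 \in l -> exists2 x, x \in l & forall y, y \in l -> F y <= F x.
Proof.
elim: l x0 => // x l ih x0 _.
case: l ih => [|y l] ih; first by exists x => [|y]; rewrite mem_seq1// => /eqP ->.
have [z zl zP] := ih y (mem_head _ _).
have [xz|zx] := leP (F x) (F z).
  exists z; first by rewrite inE zl orbT.
  by move=> t; rewrite inE => /predU1P[->//|/zP].
exists x; first exact: mem_head.
by move=> t; rewrite inE => /predU1P[->//|/zP /le_trans]; apply; exact: ltW.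
Qed.

Section ReverseIFS.
Context (R : realType) (m : nat) (r b : 'I_m -> R) (a : R).
Hypothesis r2 : forall i, 2 <= `|r i|.

Local Notation f := (fun i : 'I_m => affine (r i) (b i)).
Local Notation O := (forward_orbit f a).

(** The semigroup generated by the maps [f i], with the identity added. *)
Definition semigroup1 : set (R -> R) := [set g | semigroup f g \/ g = id].

Lemma ratio_neq0 i : r i != 0.
Proof. by rewrite -normr_gt0; apply: lt_le_trans (r2 i). Qed.

Lemma gen_inj i : injective (affine (r i) (b i)).
Proof. exact: can_inj (affineK (b i) (ratio_neq0 i)).1. Qed.

Lemma semigroup1_comp i g : semigroup1 g -> semigroup f (f i \o g).
Proof.
by move=> [gG| ->]; [apply: semigroup_comp => //|]; exact: (semigroup_gen f i).
Qed.

Lemma semigroup_decomp g : semigroup f g ->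
  exists i h, semigroup1 h /\ g = f i \o h.
Proof.
elim=> [i|g1 g2 _ [i [h [h1 ->]]] g2G _]; first by exists i, id; split; [right|].
exists i, (h \o g2); split=> //; left.
by case: h1 => [hG| ->//]; apply: semigroup_comp.
Qed.

Lemma semigroup1_inj g : semigroup1 g -> injective g.
Proof.
case=> [|-> //]; elim=> [i|g1 g2 _ i1 _ i2]; first exact: gen_inj.
exact: inj_comp.
Qed.

Lemma semigroup1_orbit g x : semigroup1 g -> O x -> O (g x).
Proof.
move=> [gG| ->//] [h hG <-]; exists (g \o h) => //.
exact: semigroup_comp.
Qed.

Lemma gen_orbit i x : O x -> O (affine (r i) (b i) x).
Proof. by apply: (@semigroup1_orbit (f i)); left; apply: (semigroup_gen f i). Qed.

Lemma gen_orbit0 i : O (affine (r i) (b i) a).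
Proof. by exists (f i) => //; exact: (semigroup_gen f i). Qed.

Lemma orbit_decomp x : O x -> exists i y, (O y \/ y = a) /\ x = affine (r i) (b i) y.
Proof.
move=> [g gG <-]; have [i [h [h1 ->]]] := semigroup_decomp gG.
exists i, (h a); split=> //.
by case: h1 => [hG| ->]; [left; exists h|right].
Qed.

Lemma lin_coef_comp i g : lin_coef (f i \o g) = r i * lin_coef g.
Proof. by rewrite /lin_coef /= /affine; ring. Qed.

Lemma lin_coef_id : lin_coef (id : R -> R) = 1.
Proof. by rewrite /lin_coef subr0. Qed.

Lemma semigroup1_affine g : semigroup1 g -> exists c d, g = affine c d /\ 1 <= `|c|.
Proof.
case=> [|->]; last first.
  by exists 1, 0; rewrite normr1; split=> //; apply/funext => x; rewrite /affine mul1r addr0.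
elim=> [i|_ _ _ [c [d [-> c1]]] _ [c' [d' [-> c'1]]]].
  by exists (r i), (b i); split=> //; apply: le_trans (r2 i); rewrite ler1n.
exists (c * c'), (c * d' + d); split; last by rewrite normrM mulr_ege1.
by apply/funext => x; rewrite /affine /=; ring.
Qed.

Lemma semigroup1_lin_coef g : semigroup1 g -> 1 <= `|lin_coef g|.
Proof.
move=> /semigroup1_affine[c [d [-> c1]]].
by rewrite /lin_coef /affine (_ : _ - _ = c)//; ring.
Qed.

(** An expanding affine map with fixed point [c] that maps a finite set into
    itself fixes the point of the set farthest from [c], so that [c] is the only
    point of the set.  Hence a finite orbit is a common fixed point. *)
Lemma orbit_infinite (i0 : 'I_m) : ~ degenerate f -> infinite_set O.
Proof.
move=> nd Ofin; apply: nd.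
have [i [y [_ _]]] := orbit_decomp (gen_orbit0 i0).
pose x0 := affine (r i0) (b i0) a.
have fin x : (x \in fset_set O) = (x \in O) by rewrite in_fset_set.
exists x0 => {i y} i.
pose c := b i / (1 - r i).
have r1 : 1 - r i != 0.
  rewrite subr_eq0; apply/eqP => r1; have := r2 i.
  by rewrite -r1 normr1 leNgt ltr1n.
have fc : affine (r i) (b i) c = c by rewrite /affine /c; field.
have x0O : x0 \in enum_fset (fset_set O).
  by rewrite fin mem_set//; exact: gen_orbit0.
have [x xO xmax] := seq_argmax (fun x => `|x - c|) x0O.
have {}xmax y : O y -> `|y - c| <= `|x - c|.
  by move=> Oy; apply: xmax; rewrite fin mem_set.
have xc : `|x - c| <= 0.
  have Ox : O x by move: xO; rewrite fin => /set_mem.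
  have := xmax _ (gen_orbit i Ox).
  rewrite -{1}fc /affine opprD addrACA subrr addr0 -mulrBr normrM.
  have := r2 i; have := normr_ge0 (x - c); set u := `|_ - c|; set v := `|r i|.
  by nra.
have := le_trans (xmax x0 (gen_orbit0 i0)) xc.
by rewrite normr_le0 subr_eq0 => /eqP ->.
Qed.

(** Freeness: if [f i \o g = f j \o h], then the infinite set [f i (g O)] lies in
    the overlap of [f i O] and [f j O]. *)
Lemma free_gen (hfo : finite_overlaps f a) (Oinf : infinite_set O) i j g h :
  semigroup1 g -> semigroup1 h -> i != j -> f i \o g <> f j \o h.
Proof.
move=> g1 h1 ij gh.
have inj : {in O &, injective (f i \o g)}.
  move=> x y _ _ /=; move=> /(@gen_inj i); exact: semigroup1_inj.
apply: Oinf; rewrite -(eq_finite_set (inj_card_eq inj)).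
apply: sub_finite_set (hfo _ _ ij) => _ [x Ox <-]; split.
  by exists (g x) => //; apply: semigroup1_orbit.
by exists (h x); [apply: semigroup1_orbit|rewrite gh].
Qed.

End ReverseIFS.

(** * Power laws for the orbit and for the semigroup *)

Section OrbitCounting.
Context (R : realType) (m : nat) (r b : 'I_m -> R) (a s : R).
Hypothesis r2 : forall i, 2 <= `|r i|.
Hypothesis m1 : (1 < m)%N.
Hypothesis s0 : 0 <= s.
Hypothesis rs : \sum_(i < m) `|r i| `^ (- s) = 1.

Local Notation f := (fun i : 'I_m => affine (r i) (b i)).
Local Notation O := (forward_orbit f a).

Lemma orbit_lattice (N : nat) x : (forall i, r i \is a Num.int) ->
  (forall i, N%:R * b i \is a Num.int) -> N%:R * a \is a Num.int ->
  O x -> N%:R * x \is a Num.int.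
Proof.
move=> rint bint aint [g gG <-]; elim: gG a aint => [i|g1 g2 _ ih1 _ ih2] x' x'int.
  by rewrite /affine mulrDr mulrCA rpredD// rpredM.
by apply: ih1; apply: ih2.
Qed.

(** The recursion is run on the orbit with [a] added, as [f i a] is an orbit point
    whose predecessor [a] need not be one. *)
Lemma orbit_card_le (N : nat) : (0 < N)%N -> (forall i, r i \is a Num.int) ->
  (forall i, N%:R * b i \is a Num.int) -> N%:R * a \is a Num.int ->
  exists C, 0 < C /\
    forall x h, 1 <= h -> card_le (O `&` `[x - h, x + h]) (C * h `^ s).
Proof.
move=> N0 rint bint aint.
pose X (p h : R) := [set x | (O x \/ x = a) /\ `|x - p| <= h].
have [|p h h1|p h x h1|C [C0 CP]] := @self_similar_card_le R m (fun i => `|r i|) s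
    R R X a (fun i => affine (r i) (b i)) (fun i p => (p - b i) / r i)
    ((2 * N).+1%:R) m1 r2 s0 rs.
- by [].
- apply: card_le_sub (lexx _) (card_le_lattice (p := p) N0 h1) => x [xO xp]; split=> //.
  by case: xO => [xO| ->//]; exact: orbit_lattice xO.
- case=> [[xO| ->]] xp; [right|by left].
  have [i [y [yO xy]]] := orbit_decomp xO.
  exists i, y; split=> //; split=> //.
  have ri0 := ratio_neq0 r2 i.
  rewrite ler_pdivlMr ?normr_gt0// -normrM.
  rewrite (_ : (y - _) * r i = x - p)//.
  by rewrite xy /affine /= mulrBl divfK//; ring.
exists C; split=> // x h h1; apply: card_le_sub (lexx _) (CP x h h1) => y [yO].
rewrite /= in_itv/= => /andP[y1 y2]; split; first by left.
by rewrite ler_distl y1 y2.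
Qed.

Lemma orbit_card_ge : infinite_set O -> finite_overlaps f a ->
  exists c h1, [/\ 0 < c, 0 < h1 &
    forall h, h1 <= h -> card_ge (O `&` `[- h, h]) (c * h `^ s)].
Proof.
move=> Oinf hfo.
(* The translations are absorbed by shrinking the interval: since
   |r i| >= 2, f i maps [-(h - beta), h - beta] into
   [-(h |r i| - beta), h |r i| - beta]. *)
pose beta := \sum_i `|b i|.
have bbeta i : `|b i| <= beta.
  by rewrite /beta (bigD1 i)//= lerDl sumr_ge0.
have beta0 : 0 <= beta by rewrite sumr_ge0.
pose Y (h : R) := [set x | O x /\ `|x| <= h - beta].
pose E0 := \bigcup_(ij in [set ij : 'I_m * 'I_m | ij.1 != ij.2])
  (f ij.1 @` O `&` f ij.2 @` O).
have E0fin : finite_set E0.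
  by apply: bigcup_finite => // -[i j] /= ij; exact: hfo.
pose E : seq R := enum_fset (fset_set E0).
have EE0 x : E0 x -> x \in E by move=> Ex; rewrite in_fset_set// mem_set.
have [l [ul lO lE]] : card_ge O ((m * size E).+1%:R : R).
  exact: card_ge_infinite.
pose h1 := \sum_(x <- l) `|x| + beta + 1.
have S0 : 0 <= \sum_(x <- l) `|x| by rewrite sumr_ge0.
have h10 : 0 < h1 by rewrite /h1; lra.
have lh1 x : x \in l -> `|x| <= h1 - beta.
  move=> xl; rewrite /h1 (big_rem x)//= addrAC addrK -addrA lerDl.
  by rewrite addr_ge0// sumr_ge0.
have [|i h x h1h [xO xh]|i j x y h k ij h1h h1k [xO _] [yO _] xy|h h1h|c [c0 cP]] :=
  @self_similar_card_ge R m (fun i => `|r i|) s R Y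
    (fun i => affine (r i) (b i)) E h1 m1 r2 s0 rs h10.
- exact: gen_inj.
- split; first exact: gen_orbit.
  rewrite /affine (le_trans (ler_normD _ _))// normrM.
  have := r2 i; have := bbeta i; have := normr_ge0 (r i).
  move: xh; set u := `|r i|; set v := `|b i|; set t := `|x| => xh u0 vb u2.
  have : u * t <= u * (h - beta) by rewrite ler_wpM2l.
  have : 0 <= (u - 2) * beta by rewrite mulr_ge0// subr_ge0.
  by rewrite !mulrBl !mulrBr; lra.
- apply: EE0; exists (i, j) => //=; split; first by exists x.
  by exists y => //; rewrite xy.
- exists l; split=> // x xl; split; first exact: lO.
  by apply: (le_trans (lh1 x xl)); rewrite lerD2r.
exists c, h1; split=> // h h1h; apply: card_ge_sub (lexx _) (cP h h1h) => x [xO xh].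
split=> //; rewrite /= in_itv/= -ler_norml (le_trans xh)//.
by rewrite lerBlDr lerDl.
Qed.

Lemma growth_card_le : exists C, 0 < C /\
  forall h, 1 <= h ->
    card_le [set g : R -> R | semigroup f g /\ `|lin_coef g| <= h] (C * h `^ s).
Proof.
pose X (p : unit) (h : R) := [set g | semigroup1 r b g /\ `|lin_coef g| <= h].
have [|p h h1|p h x h1|C [C0 CP]] := @self_similar_card_le R m (fun i => `|r i|) s
    (R -> R : choiceType) unit X id (fun i g => affine (r i) (b i) \o g)
    (fun i p => p) 0 m1 r2 s0 rs.
- by [].
- move=> [//|g l] _ /(_ g (mem_head _ _))[g1 gh].
  by have := le_lt_trans (le_trans (semigroup1_lin_coef r2 g1) gh) h1; rewrite ltxx.
- move=> [[xG| ->] xh]; [right|by left].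
  have [i [g [g1 xg]]] := semigroup_decomp xG.
  exists i, g; split=> //; split=> //.
  have ri0 := ratio_neq0 r2 i.
  rewrite ler_pdivlMr ?normr_gt0// -normrM mulrC.
  by rewrite -(lin_coef_comp r b i g) -xg.
exists C; split=> // h h1; apply: card_le_sub (lexx _) (CP tt h h1) => g [gG gh].
by split=> //; left.
Qed.

Lemma growth_card_ge : infinite_set O -> finite_overlaps f a ->
  exists c h1, 0 < c /\ forall h, h1 <= h ->
    card_ge [set g : R -> R | semigroup f g /\ `|lin_coef g| <= h] (c * h `^ s).
Proof.
move=> Oinf hfo.
pose Y (h : R) := [set g : R -> R | semigroup f g /\ `|lin_coef g| <= h].
have i0 : 'I_m by exists 0%N; apply: ltn_trans m1.
have ri0 := ratio_neq0 r2 i0.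
have h10 : 0 < `|r i0| by rewrite normr_gt0.
have [|i h g h1h [gG gh]|i j g k h h' ij _ _ [gG _] [kG _] gk|h h1h|c [c0 cP]] :=
  @self_similar_card_ge R m (fun i => `|r i|) s (R -> R : choiceType) Y
    (fun i g => affine (r i) (b i) \o g) [::] `|r i0| m1 r2 s0 rs h10.
- move=> i g h /= gh; apply/funext => x; apply: (@gen_inj R m r b r2 i).
  exact: (congr1 (@^~ x) gh).
- split; first by apply: (@semigroup1_comp _ _ r b); left.
  by rewrite lin_coef_comp normrM mulrC ler_wpM2r.
- by case: (@free_gen R m r b a r2 hfo Oinf i j g k) => //; left.
- rewrite muln0; exists [:: affine (r i0) (b i0)]; split=> // g.
  rewrite mem_seq1 => /eqP ->; split; first exact: (semigroup_gen f i0).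
  by rewrite (lin_coef_comp r b i0 id) lin_coef_id mulr1.
by exists c, `|r i0|.
Qed.

End OrbitCounting.

(** * Discrete dimensions *)

Lemma cube_size_eq (R : realType) (U : set int) (x : int) (n : nat) :
  (0 < n)%N -> U `<=` Ccube x n ->
  (forall y k, U `<=` Ccube y k -> (n <= k)%N) -> cube_size R U = n%:R.
Proof.
move=> n0 Un nmin; apply/eqP; rewrite eq_le; apply/andP; split.
  apply: ge_inf; first by exists 0 => _ [k _ <-].
  by exists n => //; split=> //; exists x.
apply: lb_le_inf; first by exists n%:R, n => //; split=> //; exists x.
by move=> _ [k [_ [y Uy]] <-]; rewrite ler_nat; exact: (nmin y).
Qed.

Lemma cube_size_Ccube (R : realType) (x : int) (n : nat) :
  (0 < n)%N -> cube_size R (Ccube x n) = n%:R.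
Proof.
move=> n0; apply: (@cube_size_eq R _ x) => // y k xy.
have : Ccube y k x by apply: xy; rewrite /Ccube /=; lia.
have : Ccube y k (x + n%:Z - 1) by apply: xy; rewrite /Ccube /=; lia.
by rewrite /Ccube /=; lia.
Qed.

(** [Vn n.+1] is the half-open integer interval [[-2^n, 2^n)]. *)
Lemma VnSE (n : nat) : Vn n.+1 = [set z | - (2 ^ n)%:Z <= z < (2 ^ n)%:Z].
Proof.
have E : (2 ^ n.+1)%:R / 2 = (2 ^ n)%:Z%:~R :> rat.
  by rewrite expnS natrM mulrC mulKf// .
apply/seteqP; split=> z; rewrite /Vn /Vcube /= E sub0r add0r -mulrNz ler_int ltr_int.
  by move=> [-> ->].
by move=> /andP[-> ->].
Qed.

Lemma Sn_sub (n : nat) : (0 < n)%N -> Sn n `<=` [set z | (`|z|%N <= 2 ^ n.-1)%N].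
Proof.
case: n => // n _; rewrite /Sn /=.
have sub : Vn n.+1 `<=` [set z | (`|z|%N <= 2 ^ n)%N] by rewrite VnSE => z /=; lia.
by case: ifP => [/eqP [n0]|_]; [move: sub; rewrite n0|move=> z [/sub]].
Qed.

Lemma cube_size_Sn (R : realType) (n : nat) : (0 < n)%N ->
  cube_size R (Sn n) = 2 ^+ n.
Proof.
case: n => // n _.
have n0 : (0 < 2 ^ n)%N by rewrite expn_gt0.
rewrite -natrX; apply: (@cube_size_eq R _ (- (2 ^ n)%:Z)); first by rewrite expn_gt0.
  have sub : Vn n.+1 `<=` Ccube (- (2 ^ n)%:Z) (2 ^ n.+1).
    by rewrite VnSE => z; rewrite /Ccube /= expnS; lia.
  by rewrite /Sn /=; case: ifP => [/eqP [n0']|_]; [move: sub; rewrite n0'|move=> z [/sub]].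
move=> y k Sy.
have mem z : - (2 ^ n)%:Z <= z < (2 ^ n)%:Z ->
    (z < - (2 ^ n.-1)%:Z \/ (2 ^ n.-1)%:Z <= z \/ n = 0%N) -> Ccube y k z.
  move=> z1 z2; apply: Sy; rewrite /Sn; case: n n0 z1 z2 => [|n] n0 /= z1 z2.
    by rewrite VnSE.
  by rewrite !VnSE /=; split=> //; lia.
have nn : n = 0%N \/ (2 ^ n = 2 * 2 ^ n.-1)%N by case: (n) => [|n']; [left|right; rewrite expnS].
have /= := mem (- (2 ^ n)%:Z).
have /= := mem ((2 ^ n)%:Z - 1).
rewrite /Ccube /= expnS; case: nn => nn; lia.
Qed.

Lemma nu_ge0 (R : realType) (alpha : R) (A F : set int) : (0 <= nu alpha A F)%E.
Proof.
apply: le_ereal_inf_tmp => _ [k [U [_ _ ->]]].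
by rewrite lee_fin sumr_ge0// => i _; exact: powR_ge0.
Qed.

(** Cover by unit cubes. *)
Lemma nu_le_card (R : realType) (alpha B : R) (A F : set int) :
  card_le (A `&` F) B -> (nu alpha A F <= (B * (cube_size R F)^-1 `^ alpha)%:E)%E.
Proof.
move=> AB; have fin := card_le_finite AB.
pose l := enum_fset (fset_set (A `&` F)).
have lB : (size l)%:R <= B.
  by apply: AB; [exact: fset_uniq|move=> z; rewrite in_fset_set// => /set_mem].
apply: (@le_trans _ _ ((size l)%:R * (cube_size R F)^-1 `^ alpha)%:E); last first.
  by rewrite lee_fin ler_wpM2r// powR_ge0.
apply: ereal_inf_lbound; exists (size l), (fun i => Ccube (nth 0 l i) 1); split.
- by move=> i; exists (nth 0 l i), 1%N.
- move=> z Az; have zl : z \in l by rewrite in_fset_set// mem_set.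
  have zi : (index z l < size l)%N by rewrite index_mem.
  exists (Ordinal zi) => //=; rewrite nth_index// /Ccube /=; lia.
- under eq_bigr do rewrite cube_size_Ccube// mul1r.
  by rewrite sumr_const card_ord mulr_natl.
Qed.

(** A cube of size at least [d(F)] costs at least 1; for the smaller ones the cost
    decreases if the exponent is raised to [s], and then the upper bound on the
    number of points in a cube applies. *)
Lemma nu_ge_card (R : realType) (alpha s B C : R) (A F : set int) :
  0 <= alpha -> alpha <= s -> 0 < C -> 0 < cube_size R F ->
  (forall x n, (0 < n)%N -> card_le (A `&` Ccube x n) (C * n%:R `^ s)) ->
  card_ge (A `&` F) B ->
  ((Num.min 1 (B / (C * cube_size R F `^ s)))%:E <= nu alpha A F)%E.
Proof.
move=> a0 als C0 dF AC [l [ul lA lB]].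
apply: le_ereal_inf_tmp => _ [k [U [UC cov ->]]]; rewrite lee_fin.
set d := cube_size R F in dF *.
have /choice[xn xnP] i : exists xn : int * nat, (0 < xn.2)%N /\ U i = Ccube xn.1 xn.2.
  by have [x [n [n0 Un]]] := UC i; exists (x, n).
have UE i : cube_size R (U i) = (xn i).2%:R.
  by have [n0 ->] := xnP i; rewrite cube_size_Ccube.
under eq_bigr do rewrite UE.
have [[i di]|/forallNP small] := pselect (exists i, d <= (xn i).2%:R).
  rewrite ge_min; apply/orP; left; rewrite (bigD1 i)//=.
  rewrite -[leLHS]addr0 lerD//; last by rewrite sumr_ge0// => j _; exact: powR_ge0.
  by rewrite powR_ge1// ler_pdivlMr// mul1r.
rewrite ge_min; apply/orP; right.
apply: (@le_trans _ _ (\sum_(i < k) ((xn i).2%:R / d) `^ s)); last first.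
  apply: ler_sum => i _; have [n0 _] := xnP i.
  apply: ger_powR => //; rewrite divr_gt0 ?ltr0n//= ler_pdivrMr// mul1r ltW//.
  by rewrite ltNge; apply/negP/small.
rewrite ler_pdivrMr ?mulr_gt0 ?powR_gt0// (le_trans lB)//.
pose G i := [seq z <- l | `[< U i z >]].
have : (size l <= \sum_(i < k) size (G i))%N.
  rewrite -[leqLHS]sum1_size.
  apply: (@leq_trans (\sum_(z <- l) \sum_(i < k) (z \in G i))).
    rewrite big_seq [in leqRHS]big_seq; apply: leq_sum => z zl.
    have [i _ Uz] := cov z (lA z zl).
    by rewrite (bigD1 i)//= mem_filter zl andbT asboolT.
  rewrite exchange_big/=; apply: leq_sum => i _.
  rewrite (sum_nat_count (mem (G i))) -size_filter uniq_leq_size ?filter_uniq//.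
  by move=> x; rewrite mem_filter => /andP[].
rewrite -(ler_nat R) => /le_trans; apply; rewrite natr_sum mulr_suml.
apply: ler_sum => i _; have [n0 Ui] := xnP i.
rewrite powRM ?invr_ge0 ?(ltW dF)// -powR_inv1 ?(ltW dF)// -powRrM mulN1r powRN.
rewrite mulrCA mulrAC -mulrA mulfV ?gt_eqF ?powR_gt0// mulr1 .
apply: (AC (xn i).1 (xn i).2 n0); first exact: filter_uniq.
move=> z; rewrite mem_filter -Ui => /andP[/asboolP Uz /lA[Az _]]; split=> //.
Qed.

Lemma powR2X (R : realType) (s : R) (n : nat) : (2 ^+ n) `^ s = (2 `^ s) ^+ n.
Proof.
elim: n => [|n ih]; first by rewrite !expr0 powR1.
by rewrite !exprS powRM ?exprn_ge0// ih.
Qed.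

Lemma powR2_gt1 (R : realType) (x : R) : 0 < x -> 1 < 2 `^ x.
Proof.
by move=> x0; rewrite /powR pnatr_eq0/= expR_gt1 mulr_gt0// ln_gt0// ltr1n.
Qed.

Lemma powR2_lt1 (R : realType) (x : R) : x < 0 -> 2 `^ x < 1.
Proof.
move=> x0; rewrite /powR pnatr_eq0/= expR_lt1 nmulr_rlt0// ln_gt0// ltr1n//.
Qed.

Lemma card_le_setU (R : realType) (T : choiceType) (X Y Z : set T) (B C : R) :
  Z `<=` X `|` Y -> card_le X B -> card_le Y C -> card_le Z (B + C).
Proof.
move=> ZXY XB YC l ul lZ.
pose P z := `[< X z >].
rewrite -(count_predC P l) natrD lerD// -size_filter.
  by apply: XB; [exact: filter_uniq|move=> z; rewrite mem_filter => /andP[/asboolP]].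
apply: YC; first exact: filter_uniq.
move=> z; rewrite mem_filter => /andP[/= /asboolPn nX /lZ/ZXY[]//].
Qed.

Lemma not_card_ge (R : realType) (T : choiceType) (X : set T) (B : R) :
  ~ card_ge X B -> card_le X B.
Proof.
move=> XB l ul lX; rewrite leNgt; apply/negP => /ltW Bl.
by apply: XB; exists l.
Qed.

Lemma norm_intr_le (R : realType) (z : int) (k : nat) :
  (`|z%:~R : R| <= k%:R) = (`|z|%N <= k)%N.
Proof. by rewrite -intr_norm [k%:R]pmulrn ler_int; lia. Qed.

Lemma cvg0_eventually_lt (R : realType) (u : nat -> \bar R) (e : R) :
  u n @[n --> \oo] --> 0%E -> 0 < e ->
  exists n0, forall n, (n0 <= n)%N -> (u n < e%:E)%E.
Proof.
move=> /fine_cvgP[ufin /cvgrPdist_lt ucv] e0.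
have [n0 _ n0P] := filterI ufin (ucv e e0).
exists n0 => n /n0P[/= un]; rewrite sub0r normrN => ue.
by rewrite -(fineK un) lte_fin (le_lt_trans (ler_norm _)).
Qed.

Lemma Vn_abs_le (n : nat) (z : int) : Vn n.+1 z -> (`|z|%N <= 2 ^ n)%N.
Proof. by rewrite VnSE /=; lia. Qed.

Lemma Vn_of_abs_lt (n : nat) (z : int) : (`|z|%N < 2 ^ n)%N -> Vn n.+1 z.
Proof. by rewrite VnSE /=; lia. Qed.

Section DiscreteDimension.
Context (R : realType) (A : set int) (s c C h1 : R).
Hypotheses (s0 : 0 < s) (c0 : 0 < c) (C0 : 0 < C).
Hypothesis Ale : forall x h : R, 1 <= h ->
  card_le [set z : int | A z /\ `|z%:~R - x| <= h] (C * h `^ s).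
Hypothesis Age : forall h : R, h1 <= h ->
  card_ge [set z : int | A z /\ `|z%:~R : R| <= h] (c * h `^ s).

Lemma nu_Sn_le (alpha : R) (n : nat) : (0 < n)%N ->
  (nu alpha A (Sn n) <= (C * (2 `^ (s - alpha)) ^+ n)%:E)%E.
Proof.
move=> n0.
have An : card_le (A `&` Sn n) (C * (2 ^+ n) `^ s).
  have h0 : 1 <= 2 ^+ n :> R by rewrite exprn_ege1// ler1n.
  apply: (card_le_sub _ (lexx _) (@Ale 0 _ h0)) => z [Az /(Sn_sub n0) /= zn].
  split=> //; rewrite subr0 -natrX norm_intr_le (leq_trans zn)//.
  by rewrite leq_exp2l// leq_pred.
apply: le_trans (nu_le_card alpha An) _.
rewrite cube_size_Sn// lee_fin -mulrA ler_pM2l//.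
rewrite powRB ?pnatr_eq0 ?implybT// exprMn -powR2X exprVn -powR2X.
by rewrite -powR_inv1 ?exprn_ge0// -powRrM mulN1r powRN.
Qed.

Lemma Ccube_card_le x n : (0 < n)%N -> card_le (A `&` Ccube x n) (C * n%:R `^ s).
Proof.
move=> n0; have h0 : 1 <= n%:R :> R by rewrite ler1n.
apply: (card_le_sub _ (lexx _) (@Ale x%:~R _ h0)) => z [Az].
rewrite /Ccube /= => zx; split=> //.
by rewrite -intrB norm_intr_le; lia.
Qed.

(** If [alpha < s] and the [nu alpha A (Sn n)] become small, then the shells [Sn n]
    contain at most [e * C * 2^(s n)] points of [A] for large [n].  Adding up the
    shells, [Vn n] contains at most [B0 + e * C * D * 2^(s n)] points, where [D] is
    the sum of the geometric series with ratio [2^(-s)]; for small [e] this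
    contradicts the lower bound. *)
Lemma exponent_ge_of_nu_cvg (alpha : R) : 0 <= alpha ->
  (forall e : R, 0 < e -> exists n0, forall n, (n0 <= n)%N ->
     (nu alpha A (Sn n) < e%:E)%E) -> s <= alpha.
Proof.
move=> a0 small; rewrite leNgt; apply/negP => /ltW als.
pose T : R := 2 `^ s.
have T1 : 1 < T by exact: powR2_gt1.
pose D := T / (T - 1).
have D0 : 0 < D by rewrite divr_gt0//; lra.
have DT : D * (T - 1) = T by rewrite /D divfK// gt_eqF//; lra.
pose c' := c / (T * T).
have c'0 : 0 < c' by rewrite divr_gt0// mulr_gt0//; lra.
pose e := Num.min 1 (c' / (2 * C * D)).
have e0 : 0 < e by rewrite lt_min ltr01 divr_gt0// mulr_gt0// mulr_gt0.
have [n0 n0P] := small e e0.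
have step n : (n0 <= n)%N -> (0 < n)%N -> card_le (A `&` Sn n) (e * C * T ^+ n).
  move=> n0n n1; apply: not_card_ge => Ace.
  have dF : 0 < cube_size R (Sn n) by rewrite cube_size_Sn// exprn_gt0.
  have Tn : 0 < T ^+ n by rewrite exprn_gt0//; lra.
  have := nu_ge_card a0 als C0 dF Ccube_card_le Ace.
  rewrite cube_size_Sn// powR2X -/T -mulrA mulfK ?gt_eqF ?mulr_gt0//.
  rewrite min_r; last by rewrite ge_min lexx.
  by move=> /le_lt_trans/(_ (n0P n n0n)); rewrite ltxx.
pose n2 := n0.+1.
have [B0 B0P] : exists B0 : R, card_le (A `&` Vn n2) B0.
  have h0 : 1 <= 2 ^+ n0 :> R by rewrite exprn_ege1// ler1n.
  exists (C * (2 ^+ n0) `^ s).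
  apply: (card_le_sub _ (lexx _) (@Ale 0 _ h0)) => z [Az /Vn_abs_le zn].
  by split=> //; rewrite subr0 -natrX norm_intr_le.
have B00 := card_le_ge0 B0P.
have up k : card_le (A `&` Vn (n2 + k)) (B0 + e * C * D * T ^+ (n2 + k)).
  elim: k => [|k ih].
    rewrite addn0; apply: (card_le_sub _ _ B0P) => //.
    have T0 : 0 <= T by apply/ltW/powR_gt0.
    by rewrite lerDl mulr_ge0// ?exprn_ge0// ltW// (mulr_gt0 (mulr_gt0 e0 C0) D0).
  have : card_le (A `&` Vn (n2 + k.+1))
      (B0 + e * C * D * T ^+ (n2 + k) + e * C * T ^+ (n2 + k.+1)).
    have kn : (n0 <= n2 + k.+1)%N by rewrite addnS /n2 addSn !leqW// leq_addr.
    apply: (card_le_setU _ ih (step (n2 + k.+1)%N kn _)); last by rewrite addnS.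
    rewrite addnS /n2 addSn => z [Az Vz].
    by have [Vz'|nVz] := pselect (Vn (n0 + k).+1 z); [left|right].
  apply: card_le_sub => //; rewrite addnS exprS.
  have -> : e * C * D * (T * T ^+ (n2 + k)) =
      e * C * (D * (T - 1)) * T ^+ (n2 + k) + e * C * D * T ^+ (n2 + k) by ring.
  by rewrite DT; lra.
have low k : h1 <= 2 ^+ (n0 + k) -> c' * T ^+ (n2 + k.+1) <= B0 + e * C * D * T ^+ (n2 + k.+1).
  move=> hk; have lhs : c' * T ^+ (n2 + k.+1) = c * (2 ^+ (n0 + k)) `^ s.
    rewrite powR2X -/T /c' /n2 addSn addnS !exprS.
    by field; rewrite gt_eqF//; lra.
  rewrite lhs; apply: card_ge_le (Age hk) (up k.+1) _ => z [Az zk].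
  split=> //; move: zk; rewrite -natrX norm_intr_le addnS /n2 addSn => zk.
  by apply/Vn_of_abs_lt/(leq_ltn_trans zk); rewrite ltn_exp2l.
have eCD : e * C * D <= c' / 2.
  apply: (@le_trans _ _ (c' / (2 * C * D) * C * D)).
    by rewrite ler_pM2r// ler_pM2r// ge_min lexx orbT.
  by rewrite (_ : _ * D = c' / 2)//; field; rewrite !gt_eqF.
have [k hk] := lt_pow2 (Num.max h1 0).
have {}low j : (k <= j)%N -> c' / 2 * T ^+ (n2 + j.+1) <= B0.
  move=> kj; have /low : h1 <= 2 ^+ (n0 + j).
    move: hk; rewrite gt_max => /andP[/ltW h1k _]; apply: (le_trans h1k).
    by apply: ler_weXn2l; [rewrite ler1n|exact: leq_trans kj (leq_addl _ _)].
  have : e * C * D * T ^+ (n2 + j.+1) <= c' / 2 * T ^+ (n2 + j.+1).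
    by rewrite ler_pM2r// exprn_gt0//; lra.
  have -> : c' * T ^+ (n2 + j.+1) = 2 * (c' / 2 * T ^+ (n2 + j.+1)) by field.
  set X := T ^+ _; lra.
have [n1 n1P] := expr_unbounded (B0 / (c' / 2)) T1.
have := low (k + n1)%N (leq_addr _ _); apply/negP; rewrite -ltNge.
have := n1P (n2 + (k + n1).+1)%N; rewrite ltr_pdivrMr ?(divr_gt0 c'0)// mulrC.
by apply; rewrite addnS leqW// addnA leq_addl.
Qed.

Lemma dims_discrete : dim_L R A = s%:E /\ dim_DH R A = s%:E.
Proof.
have rho (alpha : R) : s < alpha -> 0 < (2 : R) `^ (s - alpha) < 1.
  by move=> sa; rewrite powR_gt0//= powR2_lt1// subr_lt0.
have nuy n (alpha : R) : (nu alpha A (Sn n) < +oo)%E.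
  case: n => [|n]; last first.
    by apply: (le_lt_trans (nu_Sn_le alpha (ltn0Sn n))); rewrite ltry.
  suff S0 : card_le (A `&` Sn 0) (0 : R).
    by apply: (le_lt_trans (nu_le_card alpha S0)); rewrite ltry.
  by move=> [//|z l] _ /(_ z (mem_head _ _))[_ []].
split; apply/eqP; rewrite eq_le; apply/andP; split.
- apply/lee_addgt0Pr => e e0; apply: ereal_inf_lbound.
  exists (s + e) => //; split; first by rewrite addr_ge0 ?ltW.
  have /andP[p0 p1] : 0 < (2 : R) `^ (s - (s + e)) < 1 by apply: rho; lra.
  apply: (@squeeze_cvge _ _ _ _ (cst 0%E) _
    (fun n => (C * (2 `^ (s - (s + e))) ^+ n)%:E)).
  + by exists 1%N => // n /= n1; rewrite nu_ge0/=; exact: nu_Sn_le.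
  + exact: cvg_cst.
  + apply: cvg_EFin; first exact: nearW.
    by apply: (cvg_geometric C); rewrite ger0_norm// ltW.
- apply: le_ereal_inf_tmp => _ [alpha [a0 cv] <-]; rewrite lee_fin.
  by apply: exponent_ge_of_nu_cvg => // e; exact: cvg0_eventually_lt.
- apply/lee_addgt0Pr => e e0; apply: ereal_inf_lbound.
  exists (s + e) => //; split; first by rewrite addr_ge0 ?ltW.
  have /andP[p0 p1] : 0 < (2 : R) `^ (s - (s + e)) < 1 by apply: rho; lra.
  move: p0 p1; set p := (2 `^ _) => p0 p1.
  apply: (@le_lt_trans _ _ (C / (1 - p))%:E); last exact: ltry.
  apply: lime_le; first by apply: is_cvg_nneseries => n _ _; exact: nu_ge0.
  apply: nearW => n.
  apply: (@le_trans _ _ (\sum_(1 <= i < n) (C * p ^+ i)%:E)%E).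
    by rewrite big_nat [leRHS]big_nat; apply: lee_sum => i /andP[i1 _]; exact: nu_Sn_le.
  rewrite sumEFin lee_fin.
  apply: le_trans (geometric_le_lim n (ltW C0) p0 _); last by rewrite gtr0_norm.
  rewrite /series /=; case: n => [|n]; first by rewrite !big_geq.
  by rewrite [leRHS]big_ltn// lerDr mulr_ge0 ?exprn_ge0 ?(ltW C0) ?(ltW p0).
- apply: le_ereal_inf_tmp => _ [alpha [a0 sfin] <-]; rewrite lee_fin.
  apply: exponent_ge_of_nu_cvg => // e e0.
  pose u n := nu alpha A (Sn n).
  have u0 n : (0 <= u n)%E by exact: nu_ge0.
  have ufin : (\sum_(0 <= n <oo) u n < +oo)%E.
    by rewrite (nneseries_split 0 1)// add0n big_nat1 lte_add_pinfty ?nuy.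
  have tail := @nneseries_tail_cvg R u xpredT ufin (fun n _ => u0 n).
  have [n0 n0P] := cvg0_eventually_lt tail e0.
  exists n0 => n /n0P; apply: le_lt_trans.
  have := @nneseries_lim_ge R u xpredT n n.+1 (fun k _ _ => u0 k).
  by rewrite big_nat1.
Qed.

End DiscreteDimension.

(** * Hausdorff dimension of the attractor *)

Lemma expr_gt_poly (R : realType) (lam M : R) (m : nat) : 1 < lam ->
  exists n : nat, n.+1%:R ^+ m * M < lam ^+ n.
Proof.
move=> lam1; have lam0 : 0 < lam by apply: lt_trans lam1.
(* As mu ^+ n grows at least linearly in n, lam ^+ n = (mu ^+ n) ^+ m.+1 grows at
   least like n ^+ m.+1. *)
pose mu := lam `^ (m.+1%:R^-1).
have mu1 : 1 < mu.
  by rewrite /mu /powR gt_eqF// expR_gt1 mulr_gt0 ?invr_gt0// ln_gt0.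
have muE : mu ^+ m.+1 = lam.
  by rewrite -powR_mulrn ?powR_ge0// -powRrM mulVf// powRr1// ltW.
pose d := Num.min 1 (mu - 1).
have d0 : 0 < d by rewrite lt_min ltr01 subr_gt0.
have dmu n : d * n.+1%:R <= mu ^+ n.
  apply: le_trans (bernoulli_le n (ltW mu1)).
  have d1 : d <= 1 by rewrite ge_min lexx.
  have d2 : d <= mu - 1 by rewrite ge_min lexx orbT.
  rewrite -natr1 mulrDr mulr1 addrC lerD// mulrC.
  by rewrite ler_wpM2l.
pose n := (Num.truncn (`|M| / d ^+ m.+1)).+1.
exists n.
have Mn : `|M| < n.+1%:R * d ^+ m.+1.
  rewrite -ltr_pdivrMr ?exprn_gt0//; apply: (lt_trans (truncnS_gt _)).
  by rewrite ltr_nat.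
rewrite -muE exprAC.
apply: (@lt_le_trans _ _ ((d * n.+1%:R) ^+ m.+1)); last first.
  by rewrite lerXn2r ?nnegrE ?mulr_ge0 ?exprn_ge0 ?(ltW d0)// ltW// (lt_trans _ mu1).
rewrite exprMn (exprSr n.+1%:R) mulrCA ltr_pM2l ?exprn_gt0//.
by rewrite mulrC (le_lt_trans (ler_norm _)).
Qed.

(** The sets [{x | K (F i x)}], for [i \in W], are copies of [K] scaled down by
    [q], at distance at least [d] from each other, and there are at least
    [q `^ t] of them.  The list [l] contains the centres and the radii of balls
    that cover [K].  If one radius is at least [d / 2], there is nothing to prove;
    otherwise each ball meets at most one copy, and the induction hypothesis
    applies to the balls meeting a given copy, magnified by [F i]. *)
Lemma finite_cover_lower_bound (R : realType) (K : set R) (I : finType)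
    (W : {set I}) (F : I -> R -> R) (q d t : R) :
  K !=set0 -> 1 < q -> 0 < d -> 0 < t ->
  (forall i x y, i \in W -> `|F i x - F i y| = q * `|x - y|) ->
  (forall i y, K y -> exists x, K x /\ F i x = y) ->
  (forall i j x y, i \in W -> j \in W -> i != j ->
     K (F i x) -> K (F j y) -> d <= `|x - y|) ->
  1 <= #|W|%:R * q `^ (- t) ->
  forall l : seq (R * R), (forall p, p \in l -> 0 < p.2) ->
    (forall x, K x -> exists2 p, p \in l & `|x - p.1| < p.2) ->
  (d / 2) `^ t <= \sum_(p <- l) p.2 `^ t.
Proof.
move=> [y0 Ky0] q1 d0 t0 Fq Fsurj Fsep Wq.
have q0 : 0 < q by apply: lt_trans q1.
have W2 : (1 < #|W|)%N.
  rewrite -(ltr_nat R) ltNge; apply/negP => W1.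
  have : #|W|%:R * q `^ (- t) < 1; last by rewrite ltNge Wq.
  apply: (@le_lt_trans _ _ (q `^ (- t))); first by rewrite ler_piMl ?powR_ge0.
  by rewrite /powR gt_eqF// expR_lt1 nmulr_rlt0 ?ln_gt0// oppr_lt0.
move=> l; have [n] := ubnP (size l); elim: n l => // n ih l ln lpos lcov.
have lt0 (s : seq (R * R)) P : 0 <= \sum_(p <- s | P p) p.2 `^ t.
  by rewrite sumr_ge0// => p _; exact: powR_ge0.
have [/hasP[p pl dp]|/hasPn small] := boolP (has (fun p => d / 2 <= p.2) l).
  rewrite (big_rem p)//= (@le_trans _ _ (p.2 `^ t))// ?lerDl//.
  by apply: powR_le_lt0 => //; [rewrite divr_gt0|exact: ltW].
pose c i (p : R * R) := `[< exists x, K (F i x) /\ `|x - p.1| < p.2 >].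
have cuniq i j p : p \in l -> i \in W -> j \in W -> c i p -> c j p -> i = j.
  move=> pl iW jW /asboolP[x [Kx xp]] /asboolP[y [Ky yp]].
  apply/eqP; apply: contraT => ij.
  have := Fsep i j x y iW jW ij Kx Ky.
  have := small p pl; rewrite -ltNge => pd.
  have := ler_distD p.1 x y; rewrite (distrC p.1 y); lra.
have step i : i \in W -> q `^ (- t) * (d / 2) `^ t <= \sum_(p <- l | c i p) p.2 `^ t.
  move=> iW.
  rewrite powRN mulrC ler_pdivrMr ?powR_gt0// -big_filter mulr_suml.
  pose l' := [seq (F i p.1, q * p.2) | p <- l & c i p].
  rewrite (_ : \sum_(p <- _) _ = \sum_(p <- l') p.2 `^ t); last first.
    rewrite big_map !big_filter big_seq_cond [RHS]big_seq_cond; apply: eq_bigr => p /andP[pl _].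
    by rewrite powRM ?(ltW q0) ?(ltW (lpos _ pl))// mulrC.
  apply: ih.
  - rewrite size_map size_filter -ltnS; apply: leq_ltn_trans ln.
    rewrite ltn_neqAle count_size andbT -all_count -has_predC; apply/hasP.
    have /card_gt1P[j [j' [jW j'W jj']]] := W2.
    have [k kW ki] : exists2 k, k \in W & k != i.
      by have [ji|ji] := eqVneq j i; [exists j' => //; rewrite -ji eq_sym|exists j].
    have [x [Kx Fx]] := Fsurj k y0 Ky0; have [p pl xp] := lcov x Kx.
    exists p => //=; apply/negP => cip; move/eqP: ki; apply.
    by apply: (cuniq _ _ p) => //; apply/asboolP; exists x; rewrite Fx.
  - move=> z /mapP[p]; rewrite mem_filter => /andP[_ pl] -> /=.
    by rewrite mulr_gt0// lpos.
  - move=> y Ky; have [x [Kx Fx]] := Fsurj i y Ky; have [p pl xp] := lcov x Kx.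
    exists (F i p.1, q * p.2); last by rewrite /= -Fx Fq// ltr_pM2l.
    apply/mapP; exists p => //; rewrite mem_filter pl andbT.
    by apply/asboolP; exists x; rewrite Fx.
apply: (@le_trans _ _ (\sum_(i in W) \sum_(p <- l | c i p) p.2 `^ t)).
  apply: (@le_trans _ _ (\sum_(i in W) q `^ (- t) * (d / 2) `^ t)); last exact: ler_sum.
  by rewrite sumr_const -[leRHS]mulr_natl mulrA ler_peMl// powR_ge0.
rewrite (exchange_big_dep predT)//= big_seq [leRHS]big_seq; apply: ler_sum => p pl.
have [/existsP[i /andP[iW cip]]|/existsPn none] := boolP [exists i, (i \in W) && c i p].
  rewrite (bigD1 i) ?iW//= big1 ?addr0// => j /andP[/andP[jW cjp] ji].
  by move: ji; rewrite (cuniq j i p)// eqxx.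
by rewrite big1 ?powR_ge0// => i iWc; have := none i; rewrite iWc.
Qed.

Lemma powR_add_le (R : realType) (x y t : R) : 0 <= x -> 0 <= y -> 0 <= t ->
  (x + y) `^ t <= 2 `^ t * (x `^ t + y `^ t).
Proof.
move=> x0 y0 t0.
have le u v : 0 <= u -> u <= v -> (u + v) `^ t <= 2 `^ t * v `^ t.
  move=> u0 uv; rewrite -powRM//; last exact: le_trans uv.
  apply: ge0_ler_powR => //; rewrite ?nnegrE; lra.
have [xy|/ltW yx] := leP x y.
  by rewrite (le_trans (le _ _ x0 xy))// ler_wpM2l ?powR_ge0// lerDr powR_ge0.
by rewrite addrC (le_trans (le _ _ y0 yx))// ler_wpM2l ?powR_ge0// lerDl powR_ge0.
Qed.

Lemma sum_half_pow_le1 (R : realType) (n : nat) :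
  \sum_(0 <= i < n) (2 ^+ i.+1)^-1 <= 1 :> R.
Proof.
suff -> : \sum_(0 <= i < n) (2 ^+ i.+1)^-1 = 1 - (2 ^+ n)^-1 :> R.
  by rewrite lerBlDr lerDl invr_ge0 exprn_ge0.
elim: n => [|n ih]; first by rewrite big_geq// expr0 invr1 subrr.
rewrite big_nat_recr//= ih exprS; field.
by rewrite expf_neq0.
Qed.

Lemma diameter_ge0 (R : realType) (U : set R) : (0 <= diameter U)%E.
Proof. by apply: ereal_sup_ubound; left. Qed.

Lemma diameter_ge (R : realType) (U : set R) x y :
  U x -> U y -> (`|x - y|%:E <= diameter U)%E.
Proof. by move=> Ux Uy; apply: ereal_sup_ubound; right; exists x => //; exists y. Qed.

Lemma diameter_le (R : realType) (U : set R) (d : R) : 0 <= d ->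
  (forall x y, U x -> U y -> `|x - y| <= d) -> (diameter U <= d%:E)%E.
Proof.
move=> d0 Ud; apply: ge_ereal_sup => _ [->|[x Ux [y Uy <-]]]; rewrite lee_fin//.
exact: Ud.
Qed.

(** Each set of the cover is enlarged to an open ball of radius [d i + e i], where
    [d i] is its diameter and [e i `^ t] is a term of a geometric series; a finite
    subcover exists by compactness.  The enlargement costs a factor [2 * 2 `^ t]
    at most. *)
Lemma countable_cover_lower_bound (R : realType) (K : set R) (c0 t : R)
    (U : nat -> set R) :
  compact K -> 0 < t -> 0 < c0 ->
  (forall l : seq (R * R), (forall p, p \in l -> 0 < p.2) ->
     (forall x, K x -> exists2 p, p \in l & `|x - p.1| < p.2) ->
     c0 <= \sum_(p <- l) p.2 `^ t) ->
  (forall i, (diameter (U i) <= 1%:E)%E) -> K `<=` \bigcup_i U i ->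
  ((c0 / (2 * 2 `^ t))%:E <= \sum_(0 <= i <oo) poweR (diameter (U i)) t)%E.
Proof.
move=> Kc t0 c00 fincov U1 KU.
have two0 : 0 < 2 `^ t :> R by rewrite powR_gt0.
pose d i := fine (diameter (U i)).
have dE i : diameter (U i) = (d i)%:E.
  rewrite fineK// ge0_fin_numE ?diameter_ge0//.
  by apply: le_lt_trans (U1 i) _; rewrite ltry.
have d0 i : 0 <= d i by rewrite -lee_fin -dE diameter_ge0.
pose eta := c0 / (2 * 2 `^ t).
have eta0 : 0 < eta by rewrite divr_gt0// mulr_gt0.
pose e i := (eta / 2 ^+ i.+1) `^ t^-1.
have e0 i : 0 < e i by rewrite powR_gt0// divr_gt0// exprn_gt0.
have eE i : e i `^ t = eta / 2 ^+ i.+1.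
  rewrite /e -powRrM mulVf ?gt_eqF// powRr1// divr_ge0 ?exprn_ge0//.
  exact: ltW.
have /choice[x xP] i : exists x, forall y, U i y -> `|y - x| <= d i.
  have [[x Ux]|U0] := pselect (exists x, U i x).
    by exists x => y Uy; rewrite -lee_fin -dE diameter_ge.
  by exists 0 => y Uy; exfalso; apply: U0; exists y.
have rho0 i : 0 < d i + e i by rewrite ltr_wpDl.
move: Kc; rewrite compact_cover => /(_ nat setT (fun i => ball (x i) (d i + e i))).
case.
- by move=> i _; exact: ball_open.
- move=> y /KU[i _ Uy]; exists i => //; rewrite /ball /= distrC.
  by rewrite (le_lt_trans (xP i y Uy))// ltrDl.
move=> D _ KD.
pose n := (\max_(i <- D) i).+1.
pose l := [seq (x i, d i + e i) | i <- index_iota 0 n].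
have : c0 <= \sum_(p <- l) p.2 `^ t.
  apply: fincov; first by move=> _ /mapP[i _ ->]; exact: rho0.
  move=> y /KD[i /= iD yi]; exists (x i, d i + e i); last by rewrite distrC.
  apply/mapP; exists i => //; rewrite mem_index_iota /= ltnS.
  exact: leq_bigmax_seq.
rewrite big_map /= => c0le.
apply: (@le_trans _ _ (\sum_(0 <= i < n) poweR (diameter (U i)) t)%E); last first.
  by apply: nneseries_lim_ge => k _ _; exact: poweR_ge0.
under eq_bigr do rewrite dE poweR_EFin.
rewrite sumEFin lee_fin.
have le1 : \sum_(0 <= i < n) (d i + e i) `^ t <=
    2 `^ t * (\sum_(0 <= i < n) d i `^ t + eta).
  apply: (@le_trans _ _ (\sum_(0 <= i < n) 2 `^ t * (d i `^ t + e i `^ t))).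
    by apply: ler_sum => i _; apply: powR_add_le => //; exact: ltW.
  rewrite -mulr_sumr ler_pM2l// big_split/= lerD2l.
  under eq_bigr do rewrite eE.
  by rewrite -mulr_sumr ler_piMr ?sum_half_pow_le1// ltW.
have := le_trans c0le le1.
have E : 2 `^ t * eta = c0 / 2 by rewrite /eta; field; rewrite gt_eqF.
by rewrite -/eta -(ler_pM2l two0) mulrDr E; lra.
Qed.

Lemma absz_modz_lt (M : nat) (x : int) :
  (0 < M)%N -> (`|(x %% M%:Z)%Z| < M)%N.
Proof.
move=> M0; have Mz : 0 < M%:Z by rewrite ltz_nat.
by have := ltz_pmod x Mz; have := modz_ge0 x (lt0r_neq0 Mz); lia.
Qed.

(** Distinct integers with the same residue modulo [M] are [M] apart. *)
Lemma residue_gap (M : nat) (x y : int) : (0 < M)%N -> x != y ->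
  `|(x %% M%:Z)%Z|%N = `|(y %% M%:Z)%Z|%N -> (M <= `|x - y|)%N.
Proof.
move=> M0 xy E; have Mz : 0 < M%:Z by rewrite ltz_nat.
have /eqP : (x = y %[mod M%:Z])%Z.
  have := modz_ge0 x (lt0r_neq0 Mz); have := modz_ge0 y (lt0r_neq0 Mz).
  by move: E; lia.
rewrite eqz_mod_dvd => /dvdzP[k kE].
have k0 : k != 0 by apply: contraNneq xy => k0; rewrite -subr_eq0 kE k0 mul0r.
by rewrite kE abszM leq_pmull// absz_gt0.
Qed.

Section Attractor.
Context (R : realType) (m : nat) (r b : 'I_m -> R) (a s : R) (K : set R).
Hypothesis r2 : forall i, 2 <= `|r i|.
Hypothesis m1 : (1 < m)%N.
Hypothesis s0 : 0 < s.
Hypothesis rs : \sum_(i < m) `|r i| `^ (- s) = 1.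
Hypothesis hK : is_attractor (fun i => affine_inv (r i) (b i)) K.

Local Notation f := (fun i : 'I_m => affine (r i) (b i)).
Local Notation O := (forward_orbit f a).

(** The composition of the maps [f i] along a word, the first letter being the
    outermost map. *)
Definition word_map (w : seq 'I_m) : R -> R :=
  foldr (fun i g => affine (r i) (b i) \o g) id w.

(** The linear coefficient of [word_map w]. *)
Definition word_ratio (w : seq 'I_m) : R := \prod_(i <- w) r i.

(** Words of length [n] are indexed by the finite type of functions from ['I_n] to
    the alphabet, so that one can sum over them. *)
Definition ffun_word (n : nat) (w : {ffun 'I_n -> 'I_m}) : seq 'I_m :=
  [seq w k | k <- enum 'I_n].

Lemma word_mapE w x : word_map w x = word_ratio w * x + word_map w 0.
Proof.
rewrite /word_ratio; elim: w => [|i w ih] /=; first by rewrite big_nil mul1r addr0.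
by rewrite big_cons ih /affine; ring.
Qed.

Lemma word_mapB w x y : word_map w x - word_map w y = word_ratio w * (x - y).
Proof. by rewrite word_mapE (word_mapE w y); ring. Qed.

Lemma word_ratio_ge w : 2 ^+ size w <= `|word_ratio w|.
Proof.
rewrite /word_ratio; elim: w => [|i w ih]; first by rewrite big_nil normr1.
rewrite big_cons normrM exprS ler_pM// exprn_ge0//.
Qed.

Lemma word_ratio_gt0 w : 0 < `|word_ratio w|.
Proof. by apply: lt_le_trans (word_ratio_ge w); rewrite exprn_gt0. Qed.

Lemma word_map_semigroup1 w : semigroup1 r b (word_map w).
Proof.
elim: w => [|i w ih] /=; first by right.
by left; exact: semigroup1_comp.
Qed.

Lemma attractor_gen x : K x -> exists i, K (affine (r i) (b i) x).
Proof.
have [_ _ KE] := hK; rewrite {1}KE => -[i _ [y Ky <-]]; exists i.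
by rewrite (affineK (b i) (ratio_neq0 r2 i)).2.
Qed.

Lemma attractor_gen_inv i x : K (affine (r i) (b i) x) -> K x.
Proof.
have [_ _ KE] := hK; rewrite [in X in _ -> X]KE => Kx; exists i => //.
by exists (affine (r i) (b i) x) => //; rewrite (affineK (b i) (ratio_neq0 r2 i)).1.
Qed.

(** The sets [{x | K (word_map w x)}], [w] of length [n], cover [K]. *)
Lemma attractor_word n x : K x ->
  exists w : {ffun 'I_n -> 'I_m}, K (word_map (ffun_word w) x).
Proof.
move=> Kx.
have [w [wn Kw]] : exists w : seq 'I_m, size w = n /\ K (word_map w x).
  elim: n => [|n [w [wn Kw]]]; first by exists [::].
  by have [i Ki] := attractor_gen Kw; exists (i :: w); rewrite /= wn.
have i0 : 'I_m by exists 0%N; apply: ltn_trans m1.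
exists [ffun k : 'I_n => nth i0 w k]; rewrite /ffun_word.
rewrite (_ : map _ _ = w)//.
rewrite -[RHS](mkseq_nth i0) wn /mkseq -val_enum_ord -map_comp.
by apply: eq_map => k; rewrite /= ffunE.
Qed.

Lemma attractor_word_surj w y : K y -> exists x, K x /\ word_map w x = y.
Proof.
elim: w y => [|i w ih] y Ky; first by exists y.
have [|x [Kx xy]] := ih (affine_inv (r i) (b i) y).
  apply: (@attractor_gen_inv i).
  by rewrite (affineK (b i) (ratio_neq0 r2 i)).2.
by exists x; split=> //=; rewrite xy (affineK (b i) (ratio_neq0 r2 i)).2.
Qed.

Lemma attractor_bounded : exists D : R, 0 < D /\
  forall x y, K x -> K y -> `|x - y| <= D.
Proof.
have [_ Kc _] := hK.
have [M [_ MP]] := compact_bounded Kc.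
pose M' := `|M| + 1.
have KM x : K x -> `|x| <= M'.
  by apply: MP; rewrite /M'; have := ler_norm M; lra.
have M0 : 0 < M' by rewrite /M' ltr_wpDl.
exists (M' + M'); split; first by rewrite addr_gt0.
move=> x y /KM xM /KM yM; apply: (le_trans (ler_normB _ _)); exact: lerD.
Qed.

Lemma sum_words (n : nat) (F : 'I_m -> R) :
  \sum_(w : {ffun 'I_n -> 'I_m}) \prod_(i <- ffun_word w) F i =
  (\sum_i F i) ^+ n.
Proof.
rewrite -[in RHS](card_ord n) -prodr_const bigA_distr_bigA/=.
by apply: eq_bigr => w _; rewrite /ffun_word big_map big_enum.
Qed.

Lemma word_ratio_powR w t :
  `|word_ratio w| `^ t = \prod_(i <- w) `|r i| `^ t.
Proof.
rewrite /word_ratio; elim: w => [|i w ih]; first by rewrite !big_nil normr1 powR1.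
by rewrite !big_cons normrM powRM// ih.
Qed.

(** The cover by the sets [V w = {x | K (word_map w x)}], [w] of length [n], costs
    at most [D `^ t * lam ^+ n] with [lam < 1]. *)
Lemma hausdorff_measure_eq0 t : s < t -> hausdorff_measure t K = 0%E.
Proof.
move=> st; have t0 : 0 < t by apply: lt_trans st.
have [D [D0 KD]] := attractor_bounded.
pose lam := \sum_(i < m) `|r i| `^ (- t).
have lam0 : 0 <= lam by rewrite sumr_ge0// => i _; exact: powR_ge0.
have lam1 : lam < 1 by rewrite -rs; apply: moran_sum_lt => //; exact: ltnW.
have prem_ge0 d : (0 <= hausdorff_premeasure t d K)%E.
  apply: le_ereal_inf_tmp => _ [U [_ _ ->]].
  by apply: nneseries_ge0 => k _ _; exact: poweR_ge0.
have prem_le d n : 0 < d -> D / 2 ^+ n <= d ->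
    (hausdorff_premeasure t d K <= (D `^ t * lam ^+ n)%:E)%E.
  move=> d0 Dn.
  pose E := enum {ffun 'I_n -> 'I_m}.
  have i0 : 'I_m by exists 0%N; apply: ltn_trans m1.
  pose w0 : {ffun 'I_n -> 'I_m} := [ffun=> i0].
  pose V (w : {ffun 'I_n -> 'I_m}) := [set x | K (word_map (ffun_word w) x)].
  have diamV w : (diameter (V w) <= (D / `|word_ratio (ffun_word w)|)%:E)%E.
    apply: diameter_le; first by rewrite divr_ge0// ltW.
    move=> x y Kx Ky; rewrite ler_pdivlMr ?word_ratio_gt0// mulrC -normrM -word_mapB.
    exact: KD.
  pose U k := if (k < size E)%N then V (nth w0 E k) else set0.
  have diam0 : diameter (set0 : set R) = 0%E.
    by apply/eqP; rewrite eq_le diameter_ge0 andbT diameter_le.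
  apply: (@le_trans _ _ (\sum_(0 <= k <oo) poweR (diameter (U k)) t)%E).
    apply: ereal_inf_lbound; exists U; split=> //.
      move=> k; rewrite /U; case: ifP => _; last by rewrite diam0 lee_fin ltW.
      apply: le_trans (diamV _) _; rewrite lee_fin (le_trans _ Dn)//.
      rewrite ler_pM2l// lef_pV2 ?posrE ?word_ratio_gt0 ?exprn_gt0//.
      apply: le_trans (word_ratio_ge _).
      by rewrite /ffun_word size_map size_enum_ord.
    move=> x /(attractor_word n)[w Kw].
    have wE : (index w E < size E)%N by rewrite index_mem mem_enum.
    by exists (index w E) => //; rewrite /U wE nth_index// mem_enum.
  have Uge0 k : (0 <= poweR (diameter (U k)) t)%E by exact: poweR_ge0.
  rewrite (nneseries_split 0 (size E))//.
  rewrite [X in (_ + X)%E]eseries0 ?adde0; last first.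
    move=> k; rewrite add0n => Ek _; rewrite /U ltnNge Ek/= diam0.
    by rewrite poweR0r// gt_eqF.
  rewrite add0n -(sum_words n) mulr_sumr -sumEFin.
  rewrite -[X in (_ <= X)%E](big_enum _ _ _ _) /=.
  rewrite -/E (big_nth w0).
  rewrite big_nat [leRHS]big_nat; apply: lee_sum => k /andP[_ kE].
  rewrite /U kE -word_ratio_powR.
  set w := nth w0 E k.
  apply: (@le_trans _ _ (poweR (D / `|word_ratio (ffun_word w)|)%:E t)).
    apply: gt0_ler_poweR; rewrite ?in_itv/= ?leey ?andbT ?diameter_ge0//.
    - exact: ltW.
    - by rewrite lee_fin divr_ge0// ltW.
  rewrite poweR_EFin lee_fin powRM ?invr_ge0 ?(ltW D0)//.
  by rewrite -powR_inv1// -powRrM mulN1r.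
apply/eqP; rewrite eq_le; apply/andP; split; last first.
  apply: (@le_trans _ _ (hausdorff_premeasure t 1 K)) => //.
  by apply: ereal_sup_ubound; exists 1 => //=.
apply: ge_ereal_sup => _ [d /= d0 <-].
apply/lee_addgt0Pr => e e0; rewrite add0e.
have lam_gt0 : 0 < lam.
  have i0 : 'I_m by exists 0%N; apply: ltn_trans m1.
  rewrite /lam (bigD1 i0)//= ltr_pwDl ?powR_gt0//; first by apply: lt_le_trans (r2 i0).
  by rewrite sumr_ge0// => i _; exact: powR_ge0.
have [n1 n1P] := @expr_unbounded _ 2 (D / d) (ltr1n _ 2).
have [|n2 n2P] := @expr_unbounded _ lam^-1 (D `^ t / e); first by rewrite invf_gt1.
apply: le_trans (prem_le d (maxn n1 n2) d0 _) _.
  by have := n1P _ (leq_maxl n1 n2); rewrite ltr_pdivrMr// ler_pdivrMr ?exprn_gt0// mulrC => /ltW.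
rewrite lee_fin; have := n2P _ (leq_maxr n1 n2).
by rewrite exprVn ltr_pdivrMr// mulrC ltr_pdivlMr ?exprn_gt0// => /ltW.
Qed.

Section LowerBound.
Context (N : nat).
Hypothesis N0 : (0 < N)%N.
Hypothesis rint : forall i, r i \is a Num.int.
Hypothesis bint : forall i, N%:R * b i \is a Num.int.
Hypothesis Oinf : infinite_set O.
Hypothesis hfo : finite_overlaps f a.

Lemma word_map_free u v : size u = size v -> word_map u = word_map v -> u = v.
Proof.
elim: u v => [|i u ih] [|j v] //= [uv] E.
have [ij|ij] := eqVneq i j; last first.
  by case: (free_gen r2 hfo Oinf (word_map_semigroup1 u) (word_map_semigroup1 v) ij).
rewrite ij (ih v)// ; apply/funext => x; apply: (@gen_inj R m r b r2 i).
by have := congr1 (@^~ x) E; rewrite /= -ij.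
Qed.

Lemma word_ratio_count w : word_ratio w = \prod_i r i ^+ count_mem i w.
Proof.
rewrite /word_ratio; elim: w => [|k w ih].
  by rewrite big_nil big1// => i _; rewrite expr0.
rewrite big_cons ih; under [RHS]eq_bigr do rewrite /= exprD.
rewrite big_split/=; congr (_ * _).
rewrite (bigD1 k)//= eqxx expr1 big1 ?mulr1// => i ik.
by rewrite eq_sym (negbTE ik) expr0.
Qed.

Lemma word_map0_int w : N%:R * word_map w 0 \is a Num.int.
Proof.
elim: w => [|i w ih] /=; first by rewrite mulr0.
by rewrite /affine mulrDr mulrCA rpredD// rpredM.
Qed.

(** The label of a word consists of its letter counts, which determine its ratio,
    and of the residue of [N * word_map w 0] modulo [M], where [M > N * (D + 1)] for
    [D] a bound on the diameter of [K].  Some label is shared by a set [W] of words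
    with at least [q `^ t] elements, where [q] is the absolute value of their ratio.
    Two distinct words of [W] have translations at least [D + 1] apart, hence pieces of [K] at distance
    at least [1 / q]. *)
Lemma separated_words t : 0 < t -> t < s ->
  exists (n : nat) (W : {set {ffun 'I_n -> 'I_m}}) (q : R),
  [/\ 1 < q, forall w, w \in W -> `|word_ratio (ffun_word w)| = q,
    forall u v x y, u \in W -> v \in W -> u != v ->
      K (word_map (ffun_word u) x) -> K (word_map (ffun_word v) y) ->
      q^-1 <= `|x - y|
    & 1 <= #|W|%:R * q `^ (- t)].
Proof.
move=> t0 ts; have [D [D0 KD]] := attractor_bounded.
pose lam := \sum_(i < m) `|r i| `^ (- t).
have lam1 : 1 < lam by rewrite -rs; apply: moran_sum_lt => //; exact: ltnW.
pose M' := Num.truncn (N%:R * (D + 1)); pose M := M'.+1.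
have MD : N%:R * (D + 1) < M%:R by exact: truncnS_gt.
have [n nP] := expr_gt_poly M%:R m lam1.
have n0 : (0 < n)%N.
  by case: (n) nP => // ; rewrite expr1n mul1r expr0 ltrn1.
pose z (w : {ffun 'I_n -> 'I_m}) := Num.floor (N%:R * word_map (ffun_word w) 0).
pose label (w : {ffun 'I_n -> 'I_m}) : {ffun 'I_m -> 'I_n.+1} * 'I_M :=
  ([ffun i => inord (count_mem i (ffun_word w))], inord `|(z w %% M%:Z)%Z|%N).
have count_n w i : (count_mem i (ffun_word (n := n) w) < n.+1)%N.
  by rewrite ltnS (leq_trans (count_size _ _))// size_map size_enum_ord.
have [l lP] : exists l, 1 < \sum_(w | label w == l) `|word_ratio (ffun_word w)| `^ (- t).
  apply: contrapT => /forallNP none.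
  suff : lam ^+ n <= n.+1%:R ^+ m * M%:R by rewrite leNgt nP.
  rewrite /lam -sum_words (partition_big label predT)//=.
  apply: (@le_trans _ _ (\sum_(l : {ffun 'I_m -> 'I_n.+1} * 'I_M) 1)).
    apply: ler_sum => l _; have := none l.
    move=> /negP; rewrite -leNgt; apply: le_trans.
    by apply: ler_sum => w _; rewrite word_ratio_powR.
  by rewrite sumr_const card_prod card_ffun !card_ord natrM natrX.
pose W : {set {ffun 'I_n -> 'I_m}} := [set w | label w == l]%SET.
have [w0 w0W] : exists w, w \in W.
  apply: contrapT => /forallNP none; move: lP; rewrite big1 ?ltr10// => w wl.
  by case: (none w); rewrite inE.
have ratioW u v : u \in W -> v \in W ->
    word_ratio (ffun_word u) = word_ratio (ffun_word v).
  rewrite !inE => /eqP lu /eqP lv; rewrite !word_ratio_count; apply: eq_bigr => i _.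
  congr (_ ^+ _); have := lu; rewrite -lv => -[/ffunP/(_ i) + _].
  by rewrite !ffunE => /(congr1 val); rewrite /= !inordK.
exists n, W, `|word_ratio (ffun_word w0)|; split.
- apply: lt_le_trans (word_ratio_ge _).
  by rewrite /ffun_word size_map size_enum_ord exprn_egt1// ?ltr1n// -lt0n.
- by move=> w wW; rewrite (ratioW w w0).
- move=> u v x y uW vW uv Kx Ky.
  have zE w : N%:R * word_map (ffun_word w) 0 = (z w)%:~R.
    by rewrite /z floorK// word_map0_int.
  have zuv : z u != z v.
    apply: contra uv => /eqP zz; apply/eqP.
    have E : ffun_word u = ffun_word v.
      apply: word_map_free; first by rewrite !size_map.
      apply/funext => t'; rewrite word_mapE [RHS]word_mapE (ratioW u v)//.
      congr (_ + _); apply: (mulfI (_ : N%:R != 0)); first by rewrite pnatr_eq0 -lt0n.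
      by rewrite !zE zz.
    apply/ffunP => k; have := congr1 (fun w => nth (u k) w k) E.
    by rewrite /ffun_word !(nth_map k) -?enumT ?size_enum_ord// nth_ord_enum.
  have Mz : M%:R <= `|(z u)%:~R - (z v)%:~R| :> R.
    rewrite -intrB -intr_norm [leLHS]pmulrn ler_int -abszE lez_nat.
    apply: residue_gap => //.
    move: uW vW; rewrite !inE => /eqP + /eqP vl; rewrite -vl => -[_ /(congr1 val)].
    by rewrite /= !inordK// absz_modz_lt.
  have wn0 := word_ratio_gt0 (ffun_word w0).
  rewrite -[leLHS]mulr1 ler_pdivrMl//.
  rewrite -(ratioW u w0)// -normrM.
  have -> : word_ratio (ffun_word u) * (x - y) =
      (word_map (ffun_word u) x - word_map (ffun_word v) y) -
      (word_map (ffun_word u) 0 - word_map (ffun_word v) 0).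
    by rewrite word_mapE (word_mapE _ y) (ratioW v u)//; ring.
  have := KD _ _ Kx Ky.
  have : D + 1 <= `|word_map (ffun_word u) 0 - word_map (ffun_word v) 0|.
    have NR : 0 < N%:R :> R by rewrite ltr0n.
    rewrite -(ler_pM2l NR) (le_trans (ltW MD))// (le_trans Mz)//.
    by rewrite -!zE -mulrBr normrM gtr0_norm.
  set X := _ - _ => DX; set Y := _ - _ => YD.
  by have := lerB_dist X Y; rewrite distrC; lra.
- apply/ltW; apply: (lt_le_trans lP).
  rewrite (eq_bigr (fun=> `|word_ratio (ffun_word w0)| `^ (- t))); last first.
    by move=> w wl; rewrite (ratioW w w0)// inE.
  by rewrite sumr_const mulr_natl (_ : #|_| = #|W|)//; apply: eq_card => w; rewrite inE.
Qed.

(** The argument is carried out with an exponent [t'] strictly between [t] and [s],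
    which is positive even if [t = 0]. *)
Lemma hausdorff_measure_neq0 t : 0 <= t -> t < s -> hausdorff_measure t K != 0%E.
Proof.
move=> t0 ts; pose t' := (t + s) / 2.
have t'0 : 0 < t' by rewrite /t'; lra.
have tt' : t <= t' by rewrite /t'; lra.
have t's : t' < s by rewrite /t'; lra.
have [n [W [q [q1 Wq Wsep Wt]]]] := separated_words t'0 t's.
have [K0 Kc _] := hK.
have q0 : 0 < q by apply: lt_trans q1.
pose c0 := (q^-1 / 2) `^ t'.
have c00 : 0 < c0 by rewrite powR_gt0// !divr_gt0 ?invr_gt0.
have fincov := @finite_cover_lower_bound R K _ W
  (fun w => word_map (ffun_word w)) q q^-1 t' K0 q1.
pose c1 := c0 / (2 * 2 `^ t').
have c10 : 0 < c1 by rewrite divr_gt0// mulr_gt0// powR_gt0.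
apply/eqP => H0.
have : (hausdorff_premeasure t 1 K < c1%:E)%E.
  apply: (@le_lt_trans _ _ 0%E); last by rewrite lte_fin.
  by rewrite -H0; apply: ereal_sup_ubound; exists 1 => //=.
move=> /ereal_inf_lt[_ [U [U1 KU ->]]]; apply/negP; rewrite -leNgt.
apply: (@le_trans _ _ (\sum_(0 <= i <oo) poweR (diameter (U i)) t')%E).
  apply: (@countable_cover_lower_bound R K) => // l lpos lcov.
  apply: fincov => //; first by rewrite invr_gt0.
  - by move=> w x y wW; rewrite word_mapB normrM Wq.
  - by move=> w y; exact: attractor_word_surj.
apply: lee_nneseries => i _; first by move=> _; exact: poweR_ge0.
have := U1 i; have := diameter_ge0 (U i).
case: (diameter (U i)) => [d| |]//; rewrite !poweR_EFin !lee_fin => d0 d1.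
have [->|dn0] := eqVneq d 0; first by rewrite [leLHS]powR0 ?gt_eqF ?powR_ge0.
by apply: ger_powR => //; rewrite lt_neqAle eq_sym dn0 d0.
Qed.

Lemma hausdorff_dim_attractor : hausdorff_dim K = s%:E.
Proof.
apply/eqP; rewrite eq_le; apply/andP; split.
  apply/lee_addgt0Pr => e e0; apply: ereal_inf_lbound.
  exists (s + e) => //; split; first by rewrite addr_ge0 ?ltW.
  by apply: hausdorff_measure_eq0; rewrite ltrDl.
apply: le_ereal_inf_tmp => _ [t [t0 tK] <-]; rewrite lee_fin leNgt.
by apply/negP => ts; have := hausdorff_measure_neq0 t0 ts; rewrite tK eqxx.
Qed.

End LowerBound.

End Attractor.

(** * Clearing denominators *)

(** No map, or a single expanding one, is degenerate. *)
Lemma nondegenerate_size (R : realType) (m : nat) (r b : 'I_m -> R) :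
  (forall i, 1 < `|r i|) -> ~ degenerate (fun i => affine (r i) (b i)) -> (1 < m)%N.
Proof.
move=> r1 nd; case: m r b r1 nd => [|[|m]]// r b r1 nd; exfalso; apply: nd.
  by exists 0 => -[].
exists (b ord0 / (1 - r ord0)) => i; rewrite [i]ord1 /affine; field.
rewrite subr_eq0; apply/eqP => E; have := r1 ord0.
by rewrite -E normr1 ltxx.
Qed.

Lemma int_of_norm_int (R : realType) (x : R) :
  `|x| \is a Num.int -> x \is a Num.int.
Proof. by case: ger0P => // _; rewrite rpredN. Qed.

Lemma int_norm_ge2 (R : realType) (x : R) :
  `|x| \is a Num.int -> 1 < `|x| -> 2 <= `|x|.
Proof.
by move=> /intrP[z ->]; rewrite ltr1z -[2]/(2%:~R) ler_int; lia.
Qed.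

Lemma rational_denominator (R : realType) (x : R) : rational x ->
  exists d : nat, (0 < d)%N /\ d%:R * x \is a Num.int.
Proof.
move=> /rationalP[p [[|q] ->]].
  by exists 1%N; rewrite invr0 !mulr0.
by exists q.+1; split=> //; rewrite mulrC divfK ?pnatr_eq0// intr_int.
Qed.

Lemma common_denominator (R : realType) (m : nat) (b : 'I_m -> R) (a : R) :
  (forall i, rational (b i)) -> rational a ->
  exists N : nat, [/\ (0 < N)%N, forall i, N%:R * b i \is a Num.int
    & N%:R * a \is a Num.int].
Proof.
move=> bQ aQ; have [da [da0 daP]] := rational_denominator aQ.
have /choice[d dP] i := rational_denominator (bQ i).
exists (da * \prod_i d i)%N; split.
- by rewrite muln_gt0 da0/= prodn_gt0// => i; have [] := dP i.
- move=> i; rewrite (bigD1 i)//= mulnCA natrM mulrAC.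
  by rewrite rpredM ?natr_int//; have [] := dP i.
- by rewrite mulnC natrM -mulrA rpredM// natr_int.
Qed.

Lemma integer_points_scale (R : realType) (N : nat) (E : set R) (z : int) :
  (0 < N)%N -> integer_points (scale_set N%:Z E) z <-> E (z%:~R / N%:R).
Proof.
move=> N0; have NR : N%:R != 0 :> R by rewrite pnatr_eq0 -lt0n.
split=> [[x Ex /= xz]|Ez]; first by rewrite -xz mulrC mulKf.
by exists (z%:~R / N%:R) => //=; rewrite mulrC divfK.
Qed.

Theorem theorem6p4 (R : realType) (m : nat) (r b : 'I_m -> R) (a : R)
    (K : set R) (f := fun i : 'I_m => affine (r i) (b i))
    (hF : reverse_IFS r b)
    (hnd : ~ degenerate f)
    (hr : forall i, `|r i| \is a Num.int /\ 1 < `|r i|)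
    (hb : forall i, rational (b i))
    (ha : rational a)
    (hK : is_attractor (fun i => affine_inv (r i) (b i)) K)
    (hfo : finite_overlaps f a) :
  exists s : R,
    unique (fun t : R => \sum_(i < m) `|r i| `^ (- t) = 1) s /\
    exists N : int,
      let NO := scale_set N (forward_orbit f a) in
      NO `<=` range (fun z : int => z%:~R) /\
      [/\ dim_L R (integer_points NO) = s%:E,
          dim_DH R (integer_points NO) = s%:E,
          is_mass_dim (forward_orbit f a) s%:E,
          beurling_dim (forward_orbit f a) = s%:E &
          hausdorff_dim K = s%:E /\ is_growth_dim f s%:E].
Proof.
have m1 : (1 < m)%N by apply: nondegenerate_size hnd => i; have [] := hr i.
have r2 i : 2 <= `|r i| by have [ri r1] := hr i; exact: int_norm_ge2.
have rint i : r i \is a Num.int by apply: int_of_norm_int; have [] := hr i.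
have [s [s0 suniq]] := moran_exponent m1 r2.
exists s; split=> //; have [rs _] := suniq.
have [N [N0 bint aint]] := common_denominator hb ha.
have Oinf : infinite_set (forward_orbit f a).
  exact: (orbit_infinite r2 (Ordinal (ltnW m1)) hnd).
have [C [C0 Ole]] := orbit_card_le r2 m1 (ltW s0) rs N0 rint bint aint.
have [c [h1 [c0 h10 Oge]]] := orbit_card_ge r2 m1 (ltW s0) rs Oinf hfo.
have NR : 0 < N%:R :> R by rewrite ltr0n.
exists N%:Z => NO; split.
  move=> _ [x Ox <-]; have /intrP[z zE] := orbit_lattice rint bint aint Ox.
  by exists z.
have Ale x h : 1 <= h ->
    card_le [set z : int | integer_points NO z /\ `|z%:~R - x| <= h] (C * h `^ s).
  move=> hge1.
  apply: (@card_le_inj _ _ _ _ _ (fun z : int => z%:~R / N%:R) _ _ _ (Ole (x / N%:R) h hge1)).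
    by move=> y z _ _ /(mulIf (invr_neq0 (lt0r_neq0 NR)))/eqP; rewrite eqr_int => /eqP.
  move=> z [/(integer_points_scale _ _ N0) Oz zx]; split=> //=.
  rewrite in_itv/= -ler_distl -mulrBl normrM (gtr0_norm (_ : 0 < N%:R^-1)) ?invr_gt0//.
  by rewrite ler_pdivrMr// (le_trans zx)// ler_peMr ?ler1n// (le_trans _ hge1).
have Age h : N%:R * h1 <= h -> card_ge
    [set z : int | integer_points NO z /\ `|z%:~R : R| <= h] (c * N%:R `^ (- s) * h `^ s).
  move=> hge; have h1h : h1 <= h / N%:R by rewrite ler_pdivlMr// mulrC.
  have h0 : 0 < h / N%:R by exact: lt_le_trans h10 h1h.
  rewrite -mulrA [X in c * X](_ : _ = (h / N%:R) `^ s); last first.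
    rewrite powRM ?invr_ge0 ?(ltW NR)//; last by move: h0; rewrite pmulr_lgt0 ?invr_gt0// => /ltW.
    by rewrite -[N%:R^-1]powR_inv1 ?(ltW NR)// -powRrM mulN1r mulrC.
  have Oint x : forward_orbit f a x -> (Num.floor (N%:R * x))%:~R = N%:R * x.
    by move=> Ox; rewrite floorK//; exact: (orbit_lattice rint bint aint Ox).
  apply: (@card_ge_inj _ _ _ _ _ (fun x => Num.floor (N%:R * x)) _ _ _ (Oge _ h1h)).
    move=> x y [Ox _] [Oy _] xy; apply: (mulfI (lt0r_neq0 NR)).
    by rewrite -(Oint x)// -(Oint y)// xy.
  move=> x [Ox]; rewrite /= in_itv/= -ler_norml => xh; split.
    by apply/(integer_points_scale _ _ N0); rewrite Oint// mulrC mulKf ?gt_eqF.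
  by rewrite Oint// normrM gtr0_norm// mulrC -ler_pdivlMr.
have [dL dDH] := dims_discrete s0 (mulr_gt0 c0 (powR_gt0 (- s) NR)) C0 Ale Age.
have Ole' x h : Num.max h1 1 <= h -> card_le
    (forward_orbit f a `&` `[x - h, x + h]) (C * h `^ s).
  by rewrite ge_max => /andP[_]; exact: Ole.
have Oge' h : Num.max h1 1 <= h -> card_ge
    (forward_orbit f a `&` `[- h, h]) (c * h `^ s).
  by rewrite ge_max => /andP[+ _]; exact: Oge.
split=> //.
- apply: (is_mass_dim_of_bounds c0 C0 Oge') => h hh.
  by have := Ole' 0 h hh; rewrite sub0r add0r.
- exact: (beurling_dim_of_bounds c0 C0 Oge' Ole').
- split; first exact: (hausdorff_dim_attractor r2 m1 s0 rs hK N0 rint bint Oinf hfo).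
  have [C' [C'0 Gle]] := growth_card_le b r2 m1 (ltW s0) rs.
  have [c' [k [c'0 Gge]]] := growth_card_ge r2 m1 (ltW s0) rs Oinf hfo.
  apply: (@is_growth_dim_of_bounds _ _ _ _ c' C' (Num.max k 1)) => // h.
    by rewrite ge_max => /andP[+ _]; exact: Gge.
  by rewrite ge_max => /andP[_]; exact: Gle.
Qed.
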